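(* Let $n\ge 1$ be an integer and let $k,a,m\in\mathbb{C}$ with $\operatorname{Im}(m)\ge 0$, such that all terms occurring below are defined. Then $$\sum_{p=0}^{n-1}3^{-p}\left(i3^{p+1}\right)^k e^{2im3^p}\Big(3\left(3^p-1\right)\Phi\big(-e^{2i3^{p+1}m},-k,\tfrac16(3^{-p}a+2)\big)-3\left(3^p-1\right)e^{2im3^p}\,\Phi\big(-e^{2i3^{p+1}m},-k,\tfrac16(3^{-p}a+4)\big)-2e^{4im3^p}\,\Phi\big(-e^{2i3^{p+1}m},-k,\tfrac16(3^{-p}a+6)\big)\Big)$$ $$=-3i\left(3^n-1\right)\left(i3^n\right)^{k-1}e^{2im3^n}\,\Phi\big(-e^{2i3^nm},-k,\tfrac{3^{-n}a}{2}+1\big).$$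
   Context: $\Phi(z,s,v)$ is the Hurwitz-Lerch zeta function: for $v\in\mathbb{C}\setminus\{0,-1,-2,\dots\}$, $\Phi(z,s,v)=\sum_{j=0}^{\infty}(v+j)^{-s}z^{j}$, convergent for $|z|<1$ and all $s\in\mathbb{C}$, and also for $|z|=1$ when $\operatorname{Re}(s)>1$; for $|z|=1$ and other $s$ it is defined by analytic continuation in $s$ (for $z=1$ this is the Hurwitz zeta function, with $s=1$ excluded). For $\operatorname{Re}(v)>0$ it has the integral representation $\Phi(z,s,v)=\frac{1}{\Gamma(s)}\int_0^\infty\frac{t^{s-1}e^{-(v-1)t}}{e^t-z}\,dt$ when either $|z|\le 1$, $z\ne1$, $\operatorname{Re}(s)>0$, or $z=1$, $\operatorname{Re}(s)>1$. Here $i=\sqrt{-1}$ and all complex powers are principal values. ''All terms defined'' means that the third argument of each $\Phi$ is not in $\{0,-1,-2,\dots\}$ and that the case (first argument of $\Phi$ equal to $1$ and $k=-1$) does not occur. *)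

(* Defs.v *)
From Stdlib Require Export Reals.
From Coquelicot Require Export Coquelicot.

Local Open Scope C_scope.

Definition Cexp (z : C) : C :=
  (exp (Re z) * cos (Im z), exp (Re z) * sin (Im z))%R.

(* For z <> 0 this is the principal argument, with values in (-PI, PI];
   the value at 0 is meaningless. *)
Definition Carg (z : C) : R :=
  if Rlt_dec (Im z) 0
  then Ropp (acos (Re z / Cmod z))
  else acos (Re z / Cmod z).

Definition Clog (z : C) : C := (ln (Cmod z), Carg z).

(* Principal value of [w ^ s]; meaningful for w <> 0. *)
Definition Cpower (w s : C) : C := Cexp (s * Clog w).

Definition analytic_at (f : C -> C) (s0 : C) : Prop :=
  exists (c : nat -> C) (r : R), (0 < r)%R /\
    forall s : C, (Cmod (s - s0) < r)%R ->
      @is_pseries C_AbsRing C_NormedModule c (s - s0) (f s).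

Definition lerch_term (z s v : C) (j : nat) : C :=
  Cpower (v + INR j) (- s) * z ^ j.

Definition is_lerch_series (z s v l : C) : Prop :=
  @is_series C_AbsRing C_NormedModule (lerch_term z s v) l.

(* [f] is the analytic continuation in s, for |z| = 1, of the series, which
   converges for Re s > 1.  The continuation is to all of C when z <> 1 and to
   C minus the point 1 when z = 1; the value of [f] at an excluded point is
   unconstrained. *)
Definition is_lerch_continuation (z v : C) (f : C -> C) : Prop :=
  (forall s : C, (1 < Re s)%R -> is_lerch_series z s v (f s)) /\
  (forall s : C, ~ (z = 1 /\ s = 1) -> analytic_at f s).

Definition is_hurwitz_lerch (z s v w : C) : Prop :=
  ((Cmod z < 1)%R /\ is_lerch_series z s v w) \/
  (Cmod z = 1%R /\
   exists f : C -> C, is_lerch_continuation z v f /\ w = f s).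

(* The Hurwitz-Lerch zeta function Phi(z, s, v), for |z| <= 1 and
   [lerch_defined z s v]; a junk value elsewhere, as with [RInt]. *)
Definition hurwitz_lerch (z s v : C) : C :=
  @iota C_CompleteNormedModule (is_hurwitz_lerch z s v).

Definition lerch_defined (z s v : C) : Prop :=
  (forall j : nat, v <> - INR j) /\ ~ (z = 1 /\ s = 1).

(* Main.v *)
From Stdlib Require Import Lra Lia Classical ClassicalEpsilon Factorial Wf_nat.
Require Import Defs.
Local Open Scope C_scope.

(** Put [q = 3 ^ p], [E = exp (2 i m q)], [z = - E] and [v = a / (2 q) + 1].
    Splitting the series of Phi by residues modulo 3 gives the trisection
      [Phi(z,s,v) = 3^(-s) (Phi(z^3,s,v/3) + z Phi(z^3,s,(v+1)/3)
                            + z^2 Phi(z^3,s,(v+2)/3))],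
    and for these [z], [v] the three values on the right are exactly the ones
    in the p-th summand, the last one being the Phi of index [p + 1].
    Eliminating the first one shows that the p-th summand is [T p - T (p + 1)]
    with [T p = 3 (q - 1) / q * (i q)^k * E * Phi(z,-k,v)].  As [T 0 = 0], the
    sum telescopes to [- T n], which is the right-hand side.

    The substance is the trisection when [|z| = 1], that is for real [m], where
    Phi is an analytic continuation in [s]: the value of [hurwitz_lerch] is
    meaningful only once the continuation is known to exist and to be unique
    ([lerch_continuation_exists], [analytic_eq_except_one]).  The trisection
    then passes from [Re s > 1] to all [s] ([hurwitz_lerch_trisection]).

    Existence.  Expand [(v + j + 1)^w] in powers of [v + j] by the binomial
    series up to order [N], multiply by [z^(j+1)] and sum over [j].  The sum of
    [z^(j+1) (v+j+1)^w - z^j (v+j)^w] telescopes to [- v^w], the main terms are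
    values of Phi at [s] and at points to the right of [s], and the remainders form a
    series that is analytic for [Re w < N - 1]
    ([remainder_series_analytic], [lerch_recursion]).  Taking [w = - s] for
    [z <> 1], where Phi at [s] has the coefficient [z - 1], and [w = 1 - s] for
    [z = 1], where Phi at [s - 1] cancels and Phi at [s] has the coefficient
    [1 - s], extends the continuation by one unit to the left; these extensions
    glue by uniqueness.

    Analyticity is handled without Cauchy's theory.  [majorized f s0 rho B]
    says that [f] has an expansion at [s0] whose coefficients satisfy
    [sum |c k| rho^k <= B].  These bounds add, multiply, and pass to infinite
    sums ([majorized_series]), so that an explicit summable bound on the terms
    proves a series analytic.  Both the exponential series and the binomial
    series come from one linear differential equation along a segment
    ([Cseries_linear_ode]). *)

(** * Complex series and the exchange of double sums *)

Definition is_Cseries (a : nat -> C) (l : C) : Prop :=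
  @is_series C_AbsRing C_NormedModule a l.

Fixpoint psum (a : nat -> C) (n : nat) : C :=
  match n with O => 0 | S p => psum a p + a p end.

Fixpoint rsum (b : nat -> R) (n : nat) : R :=
  match n with O => 0%R | S p => (rsum b p + b p)%R end.

Lemma sum_n_psum a n : @sum_n C_AbelianMonoid a n = psum a (S n).
Proof.
  induction n as [|n IH].
  - rewrite sum_O. symmetry. apply Cplus_0_l.
  - rewrite sum_Sn, IH. reflexivity.
Qed.

Lemma sum_n_rsum b n : sum_n b n = rsum b (S n).
Proof.
  induction n as [|n IH].
  - rewrite sum_O. symmetry. apply Rplus_0_l.
  - rewrite sum_Sn, IH. reflexivity.
Qed.

Lemma is_Cseries_eps a l :
  is_Cseries a l <->
  forall eps : R, (0 < eps)%R ->
    exists N, forall n, (N <= n)%nat -> (Cmod (psum a n - l) < eps)%R.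
Proof.
  unfold is_Cseries, is_series. split.
  - intros H eps Heps.
    pose proof (proj1 (@filterlim_locally_ball_norm C_AbsRing _ C_NormedModule
       eventually _ (sum_n a) l) H (mkposreal eps Heps)) as [N HN].
    exists (S N). intros [|n] Hn; [lia|].
    specialize (HN n ltac:(lia)).
    unfold ball_norm in HN. rewrite <- sum_n_psum. exact HN.
  - intros H. apply (@filterlim_locally_ball_norm C_AbsRing _ C_NormedModule
       eventually _ _ l). intros [eps Heps].
    destruct (H eps Heps) as [N HN]. exists N. intros n Hn.
    specialize (HN (S n) ltac:(lia)). rewrite <- sum_n_psum in HN. exact HN.
Qed.

Lemma small_eq (x y : C) :
  (forall eps : R, (0 < eps)%R -> (Cmod (x - y) < eps)%R) -> x = y.
Proof.
  intros H. apply NNPP; intro Hn.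
  assert (Hp : (0 < Cmod (x - y))%R).
  { apply Cmod_gt_0. intro E. apply Hn.
    replace x with (x - y + y) by ring. rewrite E. ring. }
  specialize (H _ Hp). lra.
Qed.

Lemma Cmod_sym x y : Cmod (x - y) = Cmod (y - x).
Proof. rewrite <- Cmod_opp. f_equal. ring. Qed.

Lemma Cmod_triangle3 x y z : (Cmod (x - z) <= Cmod (x - y) + Cmod (y - z))%R.
Proof.
  replace (x - z) with ((x - y) + (y - z)) by ring. apply Cmod_triangle.
Qed.

Lemma is_Cseries_unique a l1 l2 : is_Cseries a l1 -> is_Cseries a l2 -> l1 = l2.
Proof.
  rewrite !is_Cseries_eps. intros H1 H2. apply small_eq. intros eps He.
  destruct (H1 (eps/2)%R ltac:(lra)) as [N1 K1].
  destruct (H2 (eps/2)%R ltac:(lra)) as [N2 K2].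
  specialize (K1 (N1+N2)%nat ltac:(lia)). specialize (K2 (N1+N2)%nat ltac:(lia)).
  rewrite Cmod_sym in K1.
  pose proof (Cmod_triangle3 l1 (psum a (N1+N2)) l2). lra.
Qed.

Lemma is_Cseries_ext a b l :
  (forall n, a n = b n) -> is_Cseries a l -> is_Cseries b l.
Proof. apply is_series_ext. Qed.

Lemma is_Cseries_value a l l' : is_Cseries a l -> l = l' -> is_Cseries a l'.
Proof. now intros H <-. Qed.

Lemma is_Cseries_plus a b la lb :
  is_Cseries a la -> is_Cseries b lb ->
  is_Cseries (fun n => a n + b n) (la + lb).
Proof. intros Ha Hb. exact (is_series_plus _ _ _ _ Ha Hb). Qed.

Lemma is_Cseries_scal c a l :
  is_Cseries a l -> is_Cseries (fun n => c * a n) (c * l).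
Proof. intros Ha. exact (is_series_scal (V:=C_NormedModule) c _ _ Ha). Qed.

Lemma is_Cseries_minus a b la lb :
  is_Cseries a la -> is_Cseries b lb ->
  is_Cseries (fun n => a n - b n) (la - lb).
Proof. intros Ha Hb. exact (is_series_minus _ _ _ _ Ha Hb). Qed.

Lemma psum_incr a n : psum a (S n) = a O + psum (fun k => a (S k)) n.
Proof.
  induction n as [|n IH].
  - simpl. ring.
  - change (psum a (S (S n))) with (psum a (S n) + a (S n)). rewrite IH. simpl. ring.
Qed.

Lemma psum_add a m n : psum a (m + n) = psum a m + psum (fun k => a (m + k)%nat) n.
Proof.
  induction n as [|n IH].
  - rewrite Nat.add_0_r. simpl. ring.
  - rewrite Nat.add_succ_r. simpl. rewrite IH. ring.
Qed.

Lemma is_Cseries_shift a m l :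
  is_Cseries (fun k => a (m + k)%nat) l <-> is_Cseries a (psum a m + l).
Proof.
  rewrite !is_Cseries_eps. split; intros H eps He.
  - destruct (H eps He) as [N HN]. exists (m + N)%nat. intros n Hn.
    specialize (HN (n - m)%nat ltac:(lia)).
    replace n with (m + (n - m))%nat by lia. rewrite psum_add.
    match goal with |- (Cmod ?x < _)%R => replace x with
      (psum (fun k : nat => a (m + k)%nat) (n - m) - l) by ring end. exact HN.
  - destruct (H eps He) as [N HN]. exists N. intros n Hn.
    specialize (HN (m + n)%nat ltac:(lia)). rewrite psum_add in HN.
    match goal with |- (Cmod ?x < _)%R => replace x with
      (psum a m + psum (fun k : nat => a (m + k)%nat) n - (psum a m + l)) by ring end.
    exact HN.
Qed.

Lemma psum_ext a b n : (forall k, (k < n)%nat -> a k = b k) -> psum a n = psum b n.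
Proof.
  induction n as [|n IH]; intros H; [reflexivity|].
  simpl. rewrite IH by (intros; apply H; lia). rewrite H by lia. reflexivity.
Qed.

Lemma rsum_le a b n : (forall k, (k < n)%nat -> (a k <= b k)%R) -> (rsum a n <= rsum b n)%R.
Proof.
  induction n as [|n IH]; intros H; [simpl; lra|].
  simpl. specialize (IH ltac:(intros; apply H; lia)). specialize (H n ltac:(lia)). lra.
Qed.

Lemma rsum_scal c a n : (rsum (fun k => c * a k) n = c * rsum a n)%R.
Proof. induction n as [|n IH]; simpl; [ring|rewrite IH; ring]. Qed.

Lemma rsum_add a m n :
  (rsum a (m + n) = rsum a m + rsum (fun k => a (m + k)%nat) n)%R.
Proof.
  induction n as [|n IH].
  - rewrite Nat.add_0_r. simpl. ring.
  - rewrite Nat.add_succ_r. simpl. rewrite IH. ring.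
Qed.

Lemma rsum_nonneg a n : (forall k, (0 <= a k)%R) -> (0 <= rsum a n)%R.
Proof. intros H. induction n as [|n IH]; simpl; [lra|specialize (H n); lra]. Qed.

Lemma half_powers_partial_sums n : (rsum (fun k => (1/2) ^ k) n <= 2)%R.
Proof.
  assert (E : rsum (fun k => (1/2) ^ k)%R n = (2 - 2 * (1/2) ^ n)%R).
  { induction n as [|n IH]; simpl; [lra|rewrite IH; lra]. }
  rewrite E. pose proof (pow_le (1/2) n ltac:(lra)). lra.
Qed.

Lemma Cmod_psum_le a n : (Cmod (psum a n) <= rsum (fun k => Cmod (a k)) n)%R.
Proof.
  induction n as [|n IH]; simpl; [rewrite Cmod_0; lra|].
  pose proof (Cmod_triangle (psum a n) (a n)). lra.
Qed.

(** Bounded partial sums of a nonnegative series stand for its convergence in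
    the whole development; this is the tail estimate they give. *)
Lemma rsum_tail_small b S :
  (forall k, (0 <= b k)%R) -> (forall n, (rsum b n <= S)%R) ->
  forall eps : R, (0 < eps)%R -> exists J, forall n,
    (rsum (fun k => b (J + k)%nat) n <= eps)%R.
Proof.
  intros Hb HS eps He.
  destruct (completeness (fun x => exists n, x = rsum b n)) as [l [Hub Hlub]].
  { exists S. intros x [n ->]. apply HS. }
  { exists 0%R. exists O. reflexivity. }
  assert (exists J, (l - eps < rsum b J)%R) as [J HJ].
  { apply NNPP. intro Hn. assert (l <= l - eps)%R; [|lra].
    apply Hlub. intros x [n ->]. apply Rnot_lt_le. intro. apply Hn. now exists n. }
  exists J. intros n. assert (rsum b (J + n) <= l)%R by (apply Hub; now exists (J+n)%nat).
  rewrite rsum_add in H. lra.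
Qed.

Lemma Cseries_limit_le a l (M : R) N0 :
  is_Cseries a l -> (forall n, (N0 <= n)%nat -> (Cmod (psum a n) <= M)%R) ->
  (Cmod l <= M)%R.
Proof.
  rewrite is_Cseries_eps. intros H HM. apply Rnot_lt_le. intro Hlt.
  destruct (H (Cmod l - M)%R ltac:(lra)) as [N HN].
  specialize (HN (N + N0)%nat ltac:(lia)). specialize (HM (N + N0)%nat ltac:(lia)).
  rewrite Cmod_sym in HN.
  pose proof (Cmod_triangle (l - psum a (N+N0)) (psum a (N+N0))) as T.
  replace (l - psum a (N+N0) + psum a (N+N0)) with l in T by ring. lra.
Qed.

Lemma Cseries_dominated a b (B : R) :
  (forall n, (Cmod (a n) <= b n)%R) -> (forall n, (rsum b n <= B)%R) ->
  exists l, is_Cseries a l /\ (Cmod l <= B)%R.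
Proof.
  intros Hab HB.
  assert (Hb : forall n, (0 <= b n)%R).
  { intro n. pose proof (Cmod_ge_0 (a n)). specialize (Hab n). lra. }
  assert (ex_series b) as Hex.
  { destruct (ex_finite_lim_seq_incr (sum_n b) B) as [l Hl].
    - intro n. rewrite sum_Sn. specialize (Hb (S n)). unfold plus; simpl. lra.
    - intro n. rewrite sum_n_rsum. apply HB.
    - exists l. exact Hl. }
  destruct (@ex_series_le C_AbsRing C_CompleteNormedModule a b) as [l Hl].
  - exact Hab.
  - exact Hex.
  - exists l. split; [exact Hl|].
    apply (Cseries_limit_le a l B O Hl). intros n _.
    eapply Rle_trans; [apply Cmod_psum_le|].
    eapply Rle_trans; [|apply (HB n)]. apply rsum_le. intros; apply Hab.
Qed.

Lemma is_Cseries_psum (c : nat -> nat -> C) (D : nat -> C) n :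
  (forall k, (k < n)%nat -> is_Cseries (fun j => c j k) (D k)) ->
  is_Cseries (fun j => psum (c j) n) (psum D n).
Proof.
  induction n as [|n IH]; intros H.
  - simpl. apply is_Cseries_eps. intros eps He. exists O. intros m _.
    replace (psum (fun _ : nat => RtoC 0) m) with (RtoC 0).
    + replace (RtoC 0 - 0) with (RtoC 0) by ring. rewrite Cmod_0. exact He.
    + induction m; simpl; [reflexivity|rewrite <- IHm; ring].
  - simpl. apply is_Cseries_plus; [apply IH; intros; apply H; lia|apply H; lia].
Qed.

Lemma rsum_switch (c : nat -> nat -> R) m n :
  (rsum (fun k => rsum (fun j => c j k) m) n = rsum (fun j => rsum (c j) n) m)%R.
Proof.
  induction n as [|n IH].
  - simpl. induction m; simpl; [reflexivity|rewrite <- IHm; ring].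
  - simpl. rewrite IH. clear IH. induction m; simpl; [ring|rewrite <- IHm; ring].
Qed.

Lemma is_Cseries_tail_le a l (B : R) n :
  is_Cseries a l -> (forall m, (rsum (fun k => Cmod (a k)) m <= B)%R) ->
  (Cmod (l - psum a n) <= B)%R.
Proof.
  intros H HB.
  apply (Cseries_limit_le (fun k => a (n + k)%nat) _ B O).
  - apply is_Cseries_shift. replace (psum a n + (l - psum a n)) with l by ring. exact H.
  - intros m _. eapply Rle_trans; [apply Cmod_psum_le|].
    specialize (HB (n + m)%nat). rewrite rsum_add in HB.
    pose proof (rsum_nonneg (fun k => Cmod (a k)) n (fun k => Cmod_ge_0 _)). lra.
Qed.

Lemma psum_limits_uniform (a : nat -> nat -> C) (l : nat -> C) n :
  (forall j, (j < n)%nat -> is_Cseries (a j) (l j)) ->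
  forall eps : R, (0 < eps)%R -> exists N, forall m, (N <= m)%nat ->
    (rsum (fun j => Cmod (l j - psum (a j) m)) n <= eps)%R.
Proof.
  induction n as [|n IH]; intros H eps He.
  - exists O. intros. simpl. lra.
  - destruct (IH ltac:(intros; apply H; lia) (eps/2)%R ltac:(lra)) as [N1 K1].
    pose proof (H n ltac:(lia)) as Hn. rewrite is_Cseries_eps in Hn.
    destruct (Hn (eps/2)%R ltac:(lra)) as [N2 K2].
    exists (N1 + N2)%nat. intros m Hm. simpl.
    specialize (K1 m ltac:(lia)). specialize (K2 m ltac:(lia)).
    rewrite Cmod_sym in K2. lra.
Qed.

(** Fubini for double series: the row sums have a summable bound [B], so up to
    an arbitrarily small error only finitely many rows matter (Tannery). *)
Lemma Cseries_switch (c : nat -> nat -> C) (F : nat -> C) (D : nat -> C) (G : C)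
    (B : nat -> R) (S : R) :
  (forall j n, (rsum (fun k => Cmod (c j k)) n <= B j)%R) ->
  (forall n, (rsum B n <= S)%R) ->
  (forall j, is_Cseries (c j) (F j)) ->
  (forall k, is_Cseries (fun j => c j k) (D k)) ->
  is_Cseries F G ->
  is_Cseries D G /\ forall n, (rsum (fun k => Cmod (D k)) n <= S)%R.
Proof.
  intros HB HS HF HD HG.
  assert (HB0 : forall j, (0 <= B j)%R) by (intro j; exact (HB j O)).
  split.
  - apply is_Cseries_eps. intros eps He.
    destruct (rsum_tail_small B S HB0 HS (eps/4)%R ltac:(lra)) as [J HJ].
    destruct (psum_limits_uniform c F J ltac:(intros; apply HF) (eps/4)%R ltac:(lra))
      as [N HN].
    exists N. intros n Hn. specialize (HN n Hn).
    assert (Hd : is_Cseries (fun j => F j - psum (c j) n) (G - psum D n)).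
    { apply is_Cseries_minus; [exact HG|]. apply is_Cseries_psum. intros; apply HD. }
    rewrite Cmod_sym.
    apply Rle_lt_trans with (eps/2)%R; [|lra].
    apply (Cseries_limit_le _ _ _ J Hd). intros m Hm.
    replace m with (J + (m - J))%nat by lia.
    eapply Rle_trans; [apply Cmod_psum_le|]. rewrite rsum_add.
    assert (rsum (fun k => Cmod (F (J + k)%nat - psum (c (J + k)%nat) n)) (m - J) <= eps/4)%R.
    { eapply Rle_trans; [|apply (HJ (m - J)%nat)]. apply rsum_le. intros k _.
      apply is_Cseries_tail_le; [apply HF|apply HB]. }
    lra.
  - intros n. apply Rnot_lt_le. intro Hlt.
    set (e := (rsum (fun k => Cmod (D k)) n - S)%R) in *.
    destruct (psum_limits_uniform (fun k j => c j k) D n ltac:(intros; apply HD) (e/2)%R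
      ltac:(unfold e; lra)) as [N HN].
    specialize (HN N (le_n _)).
    assert (rsum (fun k => Cmod (psum (fun j => c j k) N)) n <= S)%R.
    { apply Rle_trans with (rsum (fun k => rsum (fun j => Cmod (c j k)) N) n).
      - apply rsum_le. intros; apply Cmod_psum_le.
      - rewrite (rsum_switch (fun j k => Cmod (c j k))).
        eapply Rle_trans; [|apply (HS N)]. apply rsum_le. intros; apply HB. }
    assert (rsum (fun k => Cmod (D k)) n <=
       rsum (fun j => Cmod (D j - psum (fun j0 => c j0 j) N)) n +
       rsum (fun k => Cmod (psum (fun j => c j k) N)) n)%R.
    { clear. induction n as [|n IH]; simpl; [lra|].
      pose proof (Cmod_triangle (D n - psum (fun j0 => c j0 n) N) (psum (fun j0 => c j0 n) N)) as T.
      replace (D n - psum (fun j0 => c j0 n) N + psum (fun j0 => c j0 n) N) with (D n) in T by ring.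
      lra. }
    unfold e in *; lra.
Qed.

(** * Functions with an absolutely convergent expansion on a disc *)

Definition Csum (a : nat -> C) : C := @iota C_CompleteNormedModule (is_Cseries a).

Lemma Csum_correct a l : is_Cseries a l -> is_Cseries a (Csum a).
Proof.
  intros H. unfold Csum.
  apply (@iota_correct _ C_CompleteNormedModule (is_Cseries a)). exists l. split; [exact H|].
  intros y Hy. exact (is_Cseries_unique _ _ _ H Hy).
Qed.

(** The Wiener algebra of the disc: the least [B] is a submultiplicative norm.
    The disc is closed because [s0 + rho], where [sum |c k| * rho ^ k] can be
    read off from values, has to belong to it. *)
Definition majorized (f : C -> C) (s0 : C) (rho B : R) : Prop :=
  exists c : nat -> C,
    (forall n, (rsum (fun k => Cmod (c k) * rho ^ k) n <= B)%R) /\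
    forall s, (Cmod (s - s0) <= rho)%R ->
      is_Cseries (fun k => c k * (s - s0) ^ k) (f s).

Section Majorized.
Context (s0 : C) (rho : R) (Hrho : (0 < rho)%R).

Lemma majorized_ext f g B :
  (forall s, (Cmod (s - s0) <= rho)%R -> f s = g s) ->
  majorized f s0 rho B -> majorized g s0 rho B.
Proof.
  intros E [c [H1 H2]]. exists c. split; [exact H1|].
  intros s Hs. rewrite <- E by exact Hs. apply H2, Hs.
Qed.

Lemma majorized_weaken f B B' :
  (B <= B')%R -> majorized f s0 rho B -> majorized f s0 rho B'.
Proof.
  intros E [c [H1 H2]]. exists c. split; [|exact H2].
  intros n. specialize (H1 n). lra.
Qed.

Lemma pow_abs_le (c x : C) k : (Cmod x <= rho)%R ->
  (Cmod (c * x ^ k) <= Cmod c * rho ^ k)%R.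
Proof.
  intros Hx. rewrite Cmod_mult, Cmod_pow.
  apply Rmult_le_compat_l; [apply Cmod_ge_0|]. apply pow_incr. split; [apply Cmod_ge_0|exact Hx].
Qed.

Lemma majorized_bound f B s :
  majorized f s0 rho B -> (Cmod (s - s0) <= rho)%R -> (Cmod (f s) <= B)%R.
Proof.
  intros [c [H1 H2]] Hs.
  apply (Cseries_limit_le _ _ B O (H2 s Hs)). intros n _.
  eapply Rle_trans; [apply Cmod_psum_le|]. eapply Rle_trans; [|apply (H1 n)].
  apply rsum_le. intros. now apply pow_abs_le.
Qed.

Lemma majorized_nonneg f B : majorized f s0 rho B -> (0 <= B)%R.
Proof. intros [c [H1 _]]. exact (H1 O). Qed.

Lemma is_Cseries_finite (a : nat -> C) n :
  (forall k, (n <= k)%nat -> a k = 0) -> is_Cseries a (psum a n).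
Proof.
  intros H. apply is_Cseries_eps. intros eps He. exists n. intros m Hm.
  replace m with (n + (m - n))%nat by lia. rewrite psum_add.
  replace (psum (fun k => a (n + k)%nat) (m - n)) with (RtoC 0).
  - replace (psum a n + 0 - psum a n) with (RtoC 0) by ring. rewrite Cmod_0. exact He.
  - generalize (m - n)%nat. intro p. induction p; simpl; [reflexivity|].
    rewrite <- IHp, H by lia. ring.
Qed.

Lemma rsum_finite_le a n : (forall k, (0 <= a k)%R) ->
  (forall k, (n <= k)%nat -> a k = 0%R) -> forall m, (rsum a m <= rsum a n)%R.
Proof.
  intros H0 H m. destruct (Nat.le_ge_cases m n).
  - replace n with (m + (n - m))%nat by lia. rewrite rsum_add.
    pose proof (rsum_nonneg (fun k => a (m + k)%nat) (n - m) (fun k => H0 _)). lra.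
  - replace m with (n + (m - n))%nat by lia. rewrite rsum_add.
    replace (rsum (fun k => a (n + k)%nat) (m - n)) with 0%R; [lra|].
    generalize (m - n)%nat. intro p. induction p; simpl; [reflexivity|].
    rewrite <- IHp, H by lia. ring.
Qed.

Lemma majorized_const c : majorized (fun _ => c) s0 rho (Cmod c).
Proof.
  exists (fun k => match k with O => c | _ => RtoC 0 end). split.
  - intros n. eapply Rle_trans; [apply (rsum_finite_le _ 1)|].
    + intros k. apply Rmult_le_pos; [apply Cmod_ge_0|]. apply pow_le; lra.
    + intros [|k] Hk; [lia|]. rewrite Cmod_0. ring.
    + simpl. lra.
  - intros s _.
    eapply is_Cseries_value; [apply (is_Cseries_finite _ 1)|simpl; ring].
    intros [|k] Hk; [lia|]. ring.
Qed.

Lemma majorized_id : majorized (fun s => s) s0 rho (Cmod s0 + rho).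
Proof.
  exists (fun k => match k with O => s0 | S O => RtoC 1 | _ => RtoC 0 end). split.
  - intros n. eapply Rle_trans; [apply (rsum_finite_le _ 2)|].
    + intros k. apply Rmult_le_pos; [apply Cmod_ge_0|]. apply pow_le; lra.
    + intros [|[|k]] Hk; try lia. rewrite Cmod_0. ring.
    + simpl. rewrite Cmod_1. lra.
  - intros s _.
    eapply is_Cseries_value; [apply (is_Cseries_finite _ 2)|simpl; ring].
    intros [|[|k]] Hk; try lia. ring.
Qed.

Lemma majorized_plus f g A B :
  majorized f s0 rho A -> majorized g s0 rho B ->
  majorized (fun s => f s + g s) s0 rho (A + B).
Proof.
  intros [c [H1 H2]] [d [K1 K2]]. exists (fun k => c k + d k). split.
  - intros n. specialize (H1 n). specialize (K1 n).
    apply Rle_trans with (rsum (fun k => (Cmod (c k) * rho ^ k)) n +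
       rsum (fun k => (Cmod (d k) * rho ^ k)) n)%R; [|lra].
    clear -Hrho. induction n as [|n IH]; simpl; [lra|].
    assert (0 <= rho ^ n)%R by (apply pow_le; lra).
    pose proof (Cmod_triangle (c n) (d n)). nra.
  - intros s Hs. apply is_Cseries_ext with
      (fun k => c k * (s - s0) ^ k + d k * (s - s0) ^ k); [intros; ring|].
    apply is_Cseries_plus; [apply H2|apply K2]; exact Hs.
Qed.

Lemma majorized_scal a f B :
  majorized f s0 rho B -> majorized (fun s => a * f s) s0 rho (Cmod a * B).
Proof.
  intros [c [H1 H2]]. exists (fun k => a * c k). split.
  - intros n. apply Rle_trans with (rsum (fun k => Cmod a * (Cmod (c k) * rho ^ k)) n)%R.
    + apply rsum_le. intros. rewrite Cmod_mult. lra.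
    + rewrite rsum_scal. apply Rmult_le_compat_l; [apply Cmod_ge_0|apply H1].
  - intros s Hs. apply is_Cseries_ext with (fun k => a * (c k * (s - s0) ^ k)); [intros; ring|].
    apply is_Cseries_scal, H2, Hs.
Qed.

(** Completeness of this algebra: the expansion of the sum is obtained by
    summing the coefficients, which Fubini for double series justifies. *)
Lemma majorized_series (F : nat -> C -> C) (G : C -> C) (B : nat -> R) (T : R) :
  (forall j, majorized (F j) s0 rho (B j)) ->
  (forall n, (rsum B n <= T)%R) ->
  (forall s, (Cmod (s - s0) <= rho)%R -> is_Cseries (fun j => F j s) (G s)) ->
  majorized G s0 rho T.
Proof.
  intros HF HT HG.
  (* one expansion has to be chosen for each term *)
  assert (exists c : nat -> nat -> C, forall j,
    (forall n, (rsum (fun k => Cmod (c j k) * rho ^ k) n <= B j)%R) /\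
    forall s, (Cmod (s - s0) <= rho)%R ->
      is_Cseries (fun k => c j k * (s - s0) ^ k) (F j s)) as [c Hc].
  { exists (fun j => proj1_sig (constructive_indefinite_description _ (HF j))).
    intro j. exact (proj2_sig (constructive_indefinite_description _ (HF j))). }
  assert (HB : forall j, (0 <= B j)%R) by (intro j; exact (proj1 (Hc j) O)).
  assert (Hcol : forall k, is_Cseries (fun j => c j k) (Csum (fun j => c j k))).
  { intro k. assert (Hp : (0 < rho ^ k)%R) by (apply pow_lt, Hrho).
    destruct (Cseries_dominated (fun j => c j k) (fun j => / rho ^ k * B j)%R
      (/ rho ^ k * T)%R) as [l [Hl _]].
    - intro j. pose proof (proj1 (Hc j) (S k)) as H. simpl in H.
      pose proof (rsum_nonneg (fun k => Cmod (c j k) * rho ^ k)%R k) as H0.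
      specialize (H0 ltac:(intro i; apply Rmult_le_pos; [apply Cmod_ge_0|apply pow_le; lra])).
      apply Rmult_le_reg_l with (rho ^ k)%R; [exact Hp|].
      rewrite <- Rmult_assoc, Rinv_r by lra. lra.
    - intro n. rewrite rsum_scal. apply Rmult_le_compat_l; [|apply HT].
      left. apply Rinv_0_lt_compat, Hp.
    - exact (Csum_correct _ _ Hl). }
  set (D := fun k => Csum (fun j => c j k)) in *.
  assert (Hmain : forall s, (Cmod (s - s0) <= rho)%R ->
    is_Cseries (fun k => D k * (s - s0) ^ k) (G s) /\
    forall n, (rsum (fun k => Cmod (D k * (s - s0) ^ k)) n <= T)%R).
  { intros s Hs. apply (Cseries_switch (fun j k => c j k * (s - s0) ^ k)
      (fun j => F j s) _ _ B T).
    - intros j n. eapply Rle_trans; [|apply (proj1 (Hc j) n)].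
      apply rsum_le. intros. now apply pow_abs_le.
    - exact HT.
    - intro j. apply Hc, Hs.
    - intro k. apply is_Cseries_ext with (fun j => (s - s0) ^ k * c j k); [intros; ring|].
      rewrite (Cmult_comm (D k)). apply is_Cseries_scal, Hcol.
    - apply HG, Hs. }
  exists D. split.
  - intros n.
    (* the disc reaches its radius at [s0 + rho] *)
    destruct (Hmain (s0 + RtoC rho)) as [_ H].
    + replace (s0 + RtoC rho - s0) with (RtoC rho) by ring.
      rewrite Cmod_R, Rabs_pos_eq; lra.
    + eapply Rle_trans; [|apply (H n)]. apply rsum_le. intros k _.
      replace (s0 + RtoC rho - s0) with (RtoC rho) by ring.
      rewrite Cmod_mult, Cmod_pow, Cmod_R, Rabs_pos_eq; lra.
  - intros s Hs. apply Hmain, Hs.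
Qed.

Lemma majorized_monomial f B k :
  majorized f s0 rho B ->
  majorized (fun s => (s - s0) ^ k * f s) s0 rho (rho ^ k * B).
Proof.
  intros Hf. induction k as [|k IH].
  - apply majorized_ext with f; [intros; simpl; ring|].
    apply majorized_weaken with B; [simpl; lra|exact Hf].
  - destruct IH as [c [H1 H2]].
    exists (fun j => match j with O => RtoC 0 | S i => c i end). split.
    + intros [|n].
      * simpl. specialize (H1 O). simpl in H1. rewrite Rmult_assoc.
        apply Rmult_le_pos; lra.
      * change (S n) with (1 + n)%nat. rewrite rsum_add. simpl.
        rewrite Cmod_0.
        apply Rle_trans with (rsum (fun i => rho * (Cmod (c i) * rho ^ i)) n)%R.
        -- match goal with |- (0 + _ + ?x <= _)%R => apply Rle_trans with x; [lra|] end.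
           apply rsum_le. intros; lra.
        -- rewrite rsum_scal, Rmult_assoc. apply Rmult_le_compat_l; [lra|apply H1].
    + intros s Hs. specialize (H2 s Hs).
      pose proof (is_Cseries_shift (fun j => match j with O => RtoC 0 | S i => c i end * (s - s0) ^ j) 1
        ((s - s0) * ((s - s0) ^ k * f s))) as [Sh _].
      match type of Sh with _ -> is_Cseries _ ?l =>
        replace ((s - s0) ^ S k * f s) with l by (simpl; ring) end.
      apply Sh. simpl.
      apply is_Cseries_ext with (fun j => (s - s0) * (c j * (s - s0) ^ j)); [intros; ring|].
      apply is_Cseries_scal, H2.
Qed.

(** The product is the sum of the functions [c j * (s - s0) ^ j * g s], so it
    needs no Cauchy product of its own. *)
Lemma majorized_mult f g A B :
  majorized f s0 rho A -> majorized g s0 rho B ->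
  majorized (fun s => f s * g s) s0 rho (A * B).
Proof.
  intros [c [H1 H2]] Hg. pose proof (majorized_nonneg _ _ Hg) as HB.
  apply majorized_series with (F := fun j s => c j * ((s - s0) ^ j * g s))
    (B := fun j => (B * (Cmod (c j) * rho ^ j))%R).
  - intro j. apply majorized_weaken with (Cmod (c j) * (rho ^ j * B))%R; [lra|].
    apply majorized_scal, majorized_monomial, Hg.
  - intro n. rewrite rsum_scal, Rmult_comm. apply Rmult_le_compat_r; [exact HB|apply H1].
  - intros s Hs. specialize (H2 s Hs). rewrite Cmult_comm.
    apply is_Cseries_ext with (fun j => g s * (c j * (s - s0) ^ j)); [intros; ring|].
    apply is_Cseries_scal, H2.
Qed.

End Majorized.

(** Used with [alpha = 1] for translations and [alpha = -1] for the
    reflections [s |-> e - s]. *)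
Lemma majorized_isometry f alpha beta s0 rho B :
  Cmod alpha = 1%R -> majorized f (alpha * s0 + beta) rho B ->
  majorized (fun s => f (alpha * s + beta)) s0 rho B.
Proof.
  intros Ha [c [H1 H2]]. exists (fun k => c k * alpha ^ k). split.
  - intro n. eapply Rle_trans; [|apply (H1 n)]. apply rsum_le. intros k _.
    rewrite Cmod_mult, Cmod_pow, Ha, pow1. lra.
  - intros s Hs.
    assert (E : alpha * s + beta - (alpha * s0 + beta) = alpha * (s - s0)) by ring.
    specialize (H2 (alpha * s + beta)). rewrite E in H2.
    rewrite Cmod_mult, Ha, Rmult_1_l in H2. specialize (H2 Hs).
    eapply is_Cseries_ext; [|exact H2]. intro k. simpl. rewrite Cpow_mult_l. ring.
Qed.

(** Shrinking a disc of convergence makes the power series converge absolutely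
    up to the boundary. *)
Lemma analytic_at_majorized f s0 :
  analytic_at f s0 <-> exists rho B, (0 < rho)%R /\ majorized f s0 rho B.
Proof.
  assert (Epow : forall (c : nat -> C) x k,
     @scal C_AbsRing C_NormedModule (pow_n x k) (c k) = c k * x ^ k).
  { intros c x k. change (Cmult (@pow_n C_AbsRing x k) (c k) = c k * x ^ k).
    rewrite Cmult_comm. reflexivity. }
  split.
  - intros [c [r [Hr H]]].
    assert (Hs : is_Cseries (fun k => c k * (RtoC (r/2)) ^ k) (f (s0 + RtoC (r/2)))).
    { specialize (H (s0 + RtoC (r/2))).
      replace (s0 + RtoC (r/2) - s0) with (RtoC (r/2)) in H by ring.
      eapply is_Cseries_ext; [|apply H].
      - intro k. apply Epow.
      - rewrite Cmod_R, Rabs_pos_eq; lra. }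
    (* the terms of a convergent series are bounded *)
    assert (exists M, forall k, (Cmod (c k) * (r/2) ^ k <= M)%R) as [M HM].
    { rewrite is_Cseries_eps in Hs. destruct (Hs 1%R ltac:(lra)) as [N HN].
      assert (exists M, forall k, (k < N)%nat -> (Cmod (c k) * (r/2) ^ k <= M)%R) as [M HM].
      { clear. induction N as [|N [M HM]]; [exists 0%R; intros; lia|].
        exists (Rmax M (Cmod (c N) * (r/2) ^ N))%R. intros k Hk.
        destruct (Nat.eq_dec k N) as [->|]; [apply Rmax_r|].
        eapply Rle_trans; [apply HM; lia|apply Rmax_l]. }
      exists (Rmax M 2)%R. intro k. destruct (Nat.lt_ge_cases k N) as [Hk|Hk].
      - eapply Rle_trans; [apply HM, Hk|apply Rmax_l].
      - eapply Rle_trans; [|apply Rmax_r].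
        pose proof (HN k Hk) as A1. pose proof (HN (S k) ltac:(lia)) as A2. simpl in A2.
        replace (Cmod (c k) * (r/2) ^ k)%R with (Cmod (c k * RtoC (r/2) ^ k)).
        + set (l := f _) in *. set (p := psum _ _) in *. set (t := c k * _) in *.
          replace t with ((p + t - l) + (l - p)) by ring.
          pose proof (Cmod_triangle (p + t - l) (l - p)). rewrite (Cmod_sym l p) in H0. lra.
        + rewrite Cmod_mult, Cmod_pow, Cmod_R, Rabs_pos_eq; lra. }
    exists (r/4)%R, (2 * M)%R. split; [lra|]. exists c. split.
    + intro n. apply Rle_trans with (rsum (fun k => M * (1/2)^k) n)%R.
      * apply rsum_le. intros k _. replace (r/4)%R with (r/2 * (1/2))%R by field.
        rewrite Rpow_mult_distr, <- Rmult_assoc. apply Rmult_le_compat_r; [|apply HM].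
        apply pow_le; lra.
      * rewrite rsum_scal, Rmult_comm. apply Rmult_le_compat_r.
        -- specialize (HM O). pose proof (Cmod_ge_0 (c O)). simpl in HM. lra.
        -- apply half_powers_partial_sums.
    + intros s Hs'. eapply is_Cseries_ext; [|apply H; lra]. intro k. apply Epow.
  - intros [rho [B [Hr [c [H1 H2]]]]]. exists c, rho. split; [exact Hr|].
    intros s Hs. eapply is_series_ext; [|apply (H2 s); lra].
    intro k. symmetry. apply Epow.
Qed.

(** * The exponential and linear differential equations for power series *)

Lemma C_ext (x y : C) : fst x = fst y -> snd x = snd y -> x = y.
Proof. destruct x, y; simpl; intros -> ->; reflexivity. Qed.

Lemma RtoC_neq_0 (r : R) : r <> 0%R -> RtoC r <> 0.
Proof. intros H E. apply H. exact (f_equal fst E). Qed.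

Lemma Cexp_plus x y : Cexp (x + y) = Cexp x * Cexp y.
Proof.
  unfold Cexp; destruct x as [a b], y as [c d]; apply C_ext; simpl;
  rewrite exp_plus, ?cos_plus, ?sin_plus; ring.
Qed.

Lemma Cexp_0 : Cexp 0 = 1.
Proof. unfold Cexp. simpl. rewrite exp_0, cos_0, sin_0. apply C_ext; simpl; ring. Qed.

Lemma Cexp_neq_0 x : Cexp x <> 0.
Proof.
  intro E. pose proof (Cexp_plus x (- x)) as H.
  replace (x + - x) with (RtoC 0) in H by ring. rewrite Cexp_0, E, Cmult_0_l in H.
  injection H. lra.
Qed.

Lemma Cexp_opp x : Cexp (- x) = / Cexp x.
Proof.
  assert (H : Cexp x * Cexp (- x) = 1).
  { rewrite <- Cexp_plus. replace (x + - x) with (RtoC 0) by ring. apply Cexp_0. }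
  pose proof (Cexp_neq_0 x). replace (Cexp (- x)) with (/ Cexp x * (Cexp x * Cexp (- x))) by (field; auto).
  rewrite H. ring.
Qed.

Lemma Cmod_Cexp x : Cmod (Cexp x) = exp (Re x).
Proof.
  unfold Cexp, Cmod. simpl.
  replace (_ + _)%R with ((exp (Re x))²).
  - apply sqrt_Rsqr. left. apply exp_pos.
  - pose proof (sin2_cos2 (Im x)) as H. unfold Rsqr in *.
    transitivity (exp (Re x) * exp (Re x) * (sin (Im x) * sin (Im x) + cos (Im x) * cos (Im x)))%R;
      [rewrite H|]; ring.
Qed.

Lemma is_Cseries_components (a : nat -> C) (x y : R) :
  is_series (fun n => fst (a n)) x -> is_series (fun n => snd (a n)) y ->
  is_Cseries a (x, y).
Proof.
  intros Hx Hy. apply is_Cseries_eps. intros eps He.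
  assert (Hr : forall b l, is_series b l -> exists N, forall n, (N <= n)%nat ->
     (Rabs (rsum b n - l) < eps / 2)%R).
  { intros b l H.
    pose proof (proj1 (@filterlim_locally_ball_norm R_AbsRing _ R_NormedModule
       eventually _ (sum_n b) l) H (mkposreal (eps/2) ltac:(lra))) as [N HN].
    exists (S N). intros [|n] Hn; [lia|].
    specialize (HN n ltac:(lia)). unfold ball_norm in HN. rewrite <- sum_n_rsum. exact HN. }
  destruct (Hr _ _ Hx) as [N1 H1]. destruct (Hr _ _ Hy) as [N2 H2].
  exists (N1 + N2)%nat. intros n Hn. specialize (H1 n ltac:(lia)). specialize (H2 n ltac:(lia)).
  assert (E : psum a n = (rsum (fun n => fst (a n)) n, rsum (fun n => snd (a n)) n)).
  { clear. induction n as [|n IH]; [reflexivity|]. simpl. rewrite IH. reflexivity. }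
  rewrite E.
  replace ((rsum (fun n => fst (a n)) n, rsum (fun n => snd (a n)) n) - (x, y)) with
    (RtoC (rsum (fun n => fst (a n)) n - x) + Ci * RtoC (rsum (fun n => snd (a n)) n - y))
    by (apply C_ext; simpl; ring).
  eapply Rle_lt_trans; [apply Cmod_triangle|].
  rewrite Cmod_mult, Cmod_Ci, !Cmod_R. lra.
Qed.

Lemma CV_radius_gt_unit_interval (c : nat -> R) (M : R) (t : R) :
  (forall k, Rabs (c k) * 2 ^ k <= M)%R -> (0 <= t <= 1)%R ->
  Rbar_lt (Rabs t) (CV_radius c).
Proof.
  intros HM Ht. apply Rbar_lt_le_trans with 2%R.
  - simpl. rewrite Rabs_pos_eq; lra.
  - destruct (CV_radius_bounded c) as [H _]. apply H. exists M. intro n.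
    rewrite Rabs_mult, (Rabs_pos_eq (2 ^ n)); [apply HM|apply pow_le; lra].
Qed.

(** The sum [y t] of [c k * t ^ k] solves [(1 + u t) y' = b y], and
    [L = L1 + i L2] satisfies [(1 + u t) L' = b], so that [y t * Cexp (- L t)]
    is constant on [0, 1].  The factor [2 ^ k] in the bound keeps [t = 1]
    strictly inside the disc of convergence. *)
Lemma Cseries_linear_ode (c : nat -> C) (u b : C) (L1 L2 : R -> R) (M : R) :
  (forall k, Cmod (c k) * 2 ^ k <= M)%R ->
  (forall k, RtoC (INR (S k)) * c (S k) + u * RtoC (INR k) * c k = b * c k) ->
  (forall t : R, (0 <= t <= 1)%R -> 1 + u * t <> 0) ->
  (forall t : R, (0 <= t <= 1)%R -> exists d1 d2 : R,
     is_derive L1 t d1 /\ is_derive L2 t d2 /\ (d1, d2) * (1 + u * t) = b) ->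
  is_Cseries c (c O * Cexp ((L1 1%R, L2 1%R) - (L1 0%R, L2 0%R))).
Proof.
  intros HM Hc Hu HL.
  set (c1 := fun k => fst (c k)). set (c2 := fun k => snd (c k)).
  assert (Hr : forall t : R, (0 <= t <= 1)%R ->
     Rbar_lt (Rabs t) (CV_radius c1) /\ Rbar_lt (Rabs t) (CV_radius c2)).
  { intros t Ht. split; apply CV_radius_gt_unit_interval with M; try exact Ht; intro k;
    (eapply Rle_trans; [|apply HM]; apply Rmult_le_compat_r; [apply pow_le; lra|]);
    (eapply Rle_trans; [|apply Rmax_Cmod]); [apply Rmax_l|apply Rmax_r]. }
  set (y := fun t => (PSeries c1 t, PSeries c2 t) : C).
  set (p := fun t => (PSeries (PS_derive c1) t, PSeries (PS_derive c2) t) : C).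
  assert (Hy : forall t : R, (0 <= t <= 1)%R -> is_Cseries (fun k => c k * RtoC t ^ k) (y t)).
  { intros t Ht. destruct (Hr t Ht) as [R1 R2].
    apply is_Cseries_components.
    - eapply is_series_ext; [|apply PSeries_correct, CV_radius_inside, R1].
      intro k. rewrite <- RtoC_pow. simpl. rewrite pow_n_pow. unfold scal; simpl. unfold mult; simpl.
      unfold c1. ring.
    - eapply is_series_ext; [|apply PSeries_correct, CV_radius_inside, R2].
      intro k. rewrite <- RtoC_pow. simpl. rewrite pow_n_pow. unfold scal; simpl. unfold mult; simpl.
      unfold c2. ring. }
  assert (Hp : forall t : R, (0 <= t <= 1)%R ->
     is_Cseries (fun k => RtoC (INR (S k)) * c (S k) * RtoC t ^ k) (p t)).
  { intros t Ht. destruct (Hr t Ht) as [R1 R2].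
    rewrite <- CV_radius_derive in R1, R2.
    apply is_Cseries_components.
    - eapply is_series_ext; [|apply PSeries_correct, CV_radius_inside, R1].
      intro k. rewrite <- RtoC_pow. unfold PS_derive. rewrite pow_n_pow. unfold scal; simpl. unfold mult.
      cbn -[INR]. unfold c1. ring.
    - eapply is_series_ext; [|apply PSeries_correct, CV_radius_inside, R2].
      intro k. rewrite <- RtoC_pow. unfold PS_derive. rewrite pow_n_pow. unfold scal; simpl. unfold mult.
      cbn -[INR]. unfold c2. ring. }
  assert (Hode : forall t : R, (0 <= t <= 1)%R -> p t * (1 + u * t) = b * y t).
  { intros t Ht.
    assert (Htp : is_Cseries (fun k => RtoC (INR k) * c k * RtoC t ^ k) (t * p t)).
    { pose proof (is_Cseries_shift (fun k => RtoC (INR k) * c k * RtoC t ^ k) 1 (t * p t)) as [Sh _].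
      eapply is_Cseries_value; [apply Sh|simpl; ring].
      eapply is_Cseries_ext; [|apply (is_Cseries_scal t _ _ (Hp t Ht))].
      intro k. change (1 + k)%nat with (S k). rewrite Cpow_S. ring. }
    pose proof (is_Cseries_plus _ _ _ _ (Hp t Ht) (is_Cseries_scal u _ _ Htp)) as Hl.
    pose proof (is_Cseries_scal b _ _ (Hy t Ht)) as Hrr.
    replace (p t * (1 + u * t)) with (p t + u * (t * p t)) by ring.
    refine (is_Cseries_unique _ _ _ Hl _).
    eapply is_Cseries_ext; [|exact Hrr]. intro k. cbv beta.
    replace (b * (c k * RtoC t ^ k)) with (b * c k * RtoC t ^ k) by ring. rewrite <- Hc. ring. }
  assert (Hz : forall t : R, (0 <= t <= 1)%R ->
    is_derive (fun t => exp (- L1 t) * (PSeries c1 t * cos (L2 t) + PSeries c2 t * sin (L2 t)))%R t 0%R /\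
    is_derive (fun t => exp (- L1 t) * (PSeries c2 t * cos (L2 t) - PSeries c1 t * sin (L2 t)))%R t 0%R).
  { intros t Ht. destruct (HL t Ht) as [d1 [d2 [D1 [D2 Eb]]]].
    destruct (Hr t Ht) as [R1 R2].
    pose proof (is_derive_PSeries _ _ R1) as P1. pose proof (is_derive_PSeries _ _ R2) as P2.
    assert (E : p t = (d1, d2) * y t).
    { specialize (Hode t Ht). rewrite <- Eb in Hode. specialize (Hu t Ht).
      replace (p t) with (p t * (1 + u * t) / (1 + u * t)) by (field; exact Hu).
      rewrite Hode. field. exact Hu. }
    unfold p, y in E. injection E as E1 E2.
    pose proof (is_derive_unique _ _ _ D1) as U1. pose proof (is_derive_unique _ _ _ D2) as U2.
    pose proof (is_derive_unique _ _ _ P1) as V1. pose proof (is_derive_unique _ _ _ P2) as V2.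
    split; (auto_derive;
      [repeat split; first [now exists d1|now exists d2|eexists; exact P1|eexists; exact P2]|]);
    change (Derive (fun x => L1 x) t) with (Derive L1 t);
    change (Derive (fun x => L2 x) t) with (Derive L2 t);
    change (Derive (fun x => PSeries c1 x) t) with (Derive (PSeries c1) t);
    change (Derive (fun x => PSeries c2 x) t) with (Derive (PSeries c2) t);
    rewrite U1, U2, V1, V2, E1, E2; ring. }
  assert (Hfin : Cexp (- (L1 1%R, L2 1%R)) * y 1%R = Cexp (- (L1 0%R, L2 0%R)) * y 0%R).
  { pose proof (eq_is_derive _ 0 1 (fun t Ht => proj1 (Hz t Ht)) ltac:(lra)) as G1.
    pose proof (eq_is_derive _ 0 1 (fun t Ht => proj2 (Hz t Ht)) ltac:(lra)) as G2.
    cbv beta in G1, G2.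
    unfold Cexp, y. apply C_ext; simpl; rewrite !cos_neg, !sin_neg.
    - transitivity (exp (- L1 1) * (PSeries c1 1 * cos (L2 1) + PSeries c2 1 * sin (L2 1)))%R; [ring|].
      rewrite <- G1. ring.
    - transitivity (exp (- L1 1) * (PSeries c2 1 * cos (L2 1) - PSeries c1 1 * sin (L2 1)))%R; [ring|].
      rewrite <- G2. ring. }
  eapply is_Cseries_value.
  - eapply is_Cseries_ext; [|apply (Hy 1%R); lra]. intro k. cbv beta. rewrite Cpow_1_l. ring.
  - assert (y 0%R = c O) as Y0.
    { unfold y. rewrite !PSeries_0. unfold c1, c2. now rewrite <- surjective_pairing. }
    rewrite Y0, !Cexp_opp in Hfin. unfold Cminus. rewrite Cexp_plus, Cexp_opp.
    set (e1 := Cexp (L1 1%R, L2 1%R)) in *. pose proof (Cexp_neq_0 (L1 1%R, L2 1%R)) as Hn. fold e1 in Hn.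
    replace (y 1%R) with (e1 * (/ e1 * y 1%R)) by (field; exact Hn). rewrite Hfin. ring.
Qed.

Lemma exp_partial_sums (x : R) n : (0 <= x)%R ->
  (rsum (fun k => / INR (fact k) * x ^ k) n <= exp x)%R.
Proof.
  intros Hx.
  apply Rle_trans with (sum_f_R0 (fun k => / INR (fact k) * x ^ k)%R n).
  - destruct n as [|n].
    + simpl. lra.
    + rewrite <- sum_n_rsum, sum_n_Reals, tech5.
      assert (0 <= / INR (fact (S n)) * x ^ (S n))%R; [|lra].
      apply Rmult_le_pos; [left; apply Rinv_0_lt_compat, INR_fact_lt_0|apply pow_le, Hx].
  - apply sum_incr.
    + unfold exp. destruct (exist_exp x) as [l Hl]. exact Hl.
    + intro k. apply Rmult_le_pos; [left; apply Rinv_0_lt_compat, INR_fact_lt_0|apply pow_le, Hx].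
Qed.

Lemma Cexp_series x : is_Cseries (fun k => / RtoC (INR (fact k)) * x ^ k) (Cexp x).
Proof.
  assert (Hm : forall k, Cmod (/ RtoC (INR (fact k)) * x ^ k) = (/ INR (fact k) * Cmod x ^ k)%R).
  { intro k. pose proof (INR_fact_lt_0 k).
    rewrite <- RtoC_inv by lra. rewrite Cmod_mult, Cmod_pow, Cmod_R, Rabs_pos_eq; [reflexivity|].
    left. now apply Rinv_0_lt_compat. }
  eapply is_Cseries_value.
  - apply (Cseries_linear_ode (fun k => / RtoC (INR (fact k)) * x ^ k) 0 x
      (fun t => t * fst x)%R (fun t => t * snd x)%R (exp (2 * Cmod x))).
    + intro k. rewrite Hm.
      pose proof (exp_partial_sums (2 * Cmod x) (S k) ltac:(pose proof (Cmod_ge_0 x); lra)) as H.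
      eapply Rle_trans; [|exact H]. simpl.
      assert (0 <= rsum (fun k => / INR (fact k) * (2 * Cmod x) ^ k) k)%R.
      { apply rsum_nonneg. intro j. apply Rmult_le_pos.
        - left. apply Rinv_0_lt_compat, INR_fact_lt_0.
        - apply pow_le. pose proof (Cmod_ge_0 x). lra. }
      rewrite Rpow_mult_distr in *. lra.
    + intro k. pose proof (INR_fact_lt_0 k). pose proof (lt_0_INR (S k) ltac:(lia)).
      rewrite fact_simpl, mult_INR, RtoC_mult, Cpow_S. field. split; apply RtoC_neq_0; lra.
    + intros t _ E. apply (f_equal fst) in E. simpl in E. lra.
    + intros t _. exists (fst x), (snd x). split; [|split].
      * auto_derive; [exact I|ring].
      * auto_derive; [exact I|ring].
      * apply C_ext; simpl; ring.
  - replace ((1 * fst x, 1 * snd x)%R - (0 * fst x, 0 * snd x)%R) with x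
      by (apply C_ext; simpl; ring).
    simpl. field.
Qed.

Lemma majorized_Cexp (L s0 : C) (rho : R) : (0 < rho)%R ->
  majorized (fun s => Cexp (s * L)) s0 rho (Cmod (Cexp (s0 * L)) * exp (rho * Cmod L)).
Proof.
  intros Hrho. exists (fun k => Cexp (s0 * L) * (/ RtoC (INR (fact k)) * L ^ k)). split.
  - intro n. apply Rle_trans with
      (rsum (fun k => Cmod (Cexp (s0 * L)) * (/ INR (fact k) * (rho * Cmod L) ^ k)) n)%R.
    + apply rsum_le. intros k _. pose proof (INR_fact_lt_0 k).
      rewrite <- RtoC_inv by lra. rewrite !Cmod_mult, Cmod_pow, Cmod_R, Rabs_pos_eq.
      * rewrite Rpow_mult_distr. lra.
      * left. now apply Rinv_0_lt_compat.
    + rewrite rsum_scal. apply Rmult_le_compat_l; [apply Cmod_ge_0|].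
      apply exp_partial_sums. apply Rmult_le_pos; [lra|apply Cmod_ge_0].
  - intros s _.
    eapply is_Cseries_value.
    + eapply is_Cseries_ext; [|apply (is_Cseries_scal (Cexp (s0 * L)) _ _ (Cexp_series ((s - s0) * L)))].
      intro k. cbv beta. rewrite Cpow_mult_l. ring.
    + rewrite <- Cexp_plus. f_equal. ring.
Qed.

(** * Analytic functions and uniqueness of continuation *)

Lemma majorized_shrink f s0 rho rho' B :
  (0 <= rho' <= rho)%R -> majorized f s0 rho B -> majorized f s0 rho' B.
Proof.
  intros Hr [c [H1 H2]]. exists c. split.
  - intro n. eapply Rle_trans; [|apply (H1 n)]. apply rsum_le. intros k _.
    apply Rmult_le_compat_l; [apply Cmod_ge_0|]. now apply pow_incr.
  - intros s Hs. apply H2. lra.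
Qed.

Definition near (s0 : C) (P : C -> Prop) : Prop :=
  exists delta : R, (0 < delta)%R /\ forall s, (Cmod (s - s0) < delta)%R -> P s.

Lemma analytic_at_ext_near f g s0 :
  near s0 (fun s => f s = g s) -> analytic_at f s0 -> analytic_at g s0.
Proof.
  intros [d [Hd E]] [c [r [Hr H]]]. exists c, (Rmin d r). split.
  - now apply Rmin_pos.
  - intros s Hs. rewrite <- E.
    + apply H. eapply Rlt_le_trans; [exact Hs|apply Rmin_r].
    + eapply Rlt_le_trans; [exact Hs|apply Rmin_l].
Qed.

Lemma analytic_at_ext f g s0 : (forall s, f s = g s) -> analytic_at f s0 -> analytic_at g s0.
Proof. intros E. apply analytic_at_ext_near. exists 1%R. split; [lra|]. intros; apply E. Qed.

Lemma analytic_at_const c s0 : analytic_at (fun _ => c) s0.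
Proof.
  apply analytic_at_majorized. exists 1%R, (Cmod c). split; [lra|].
  apply majorized_const. lra.
Qed.

Lemma analytic_at_id s0 : analytic_at (fun s => s) s0.
Proof.
  apply analytic_at_majorized. exists 1%R, (Cmod s0 + 1)%R. split; [lra|].
  apply majorized_id. lra.
Qed.

Lemma analytic_at_plus f g s0 :
  analytic_at f s0 -> analytic_at g s0 -> analytic_at (fun s => f s + g s) s0.
Proof.
  rewrite !analytic_at_majorized. intros [r1 [A [H1 HA]]] [r2 [B [H2 HB]]].
  assert (0 < Rmin r1 r2)%R by now apply Rmin_pos.
  exists (Rmin r1 r2), (A + B)%R. split; [assumption|]. apply majorized_plus; [assumption| |].
  - apply majorized_shrink with r1; [split; [lra|apply Rmin_l]|exact HA].
  - apply majorized_shrink with r2; [split; [lra|apply Rmin_r]|exact HB].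
Qed.

Lemma analytic_at_mult f g s0 :
  analytic_at f s0 -> analytic_at g s0 -> analytic_at (fun s => f s * g s) s0.
Proof.
  rewrite !analytic_at_majorized. intros [r1 [A [H1 HA]]] [r2 [B [H2 HB]]].
  assert (0 < Rmin r1 r2)%R by now apply Rmin_pos.
  exists (Rmin r1 r2), (A * B)%R. split; [assumption|]. apply majorized_mult; [assumption| |].
  - apply majorized_shrink with r1; [split; [lra|apply Rmin_l]|exact HA].
  - apply majorized_shrink with r2; [split; [lra|apply Rmin_r]|exact HB].
Qed.

Lemma analytic_at_scal c f s0 : analytic_at f s0 -> analytic_at (fun s => c * f s) s0.
Proof. apply (analytic_at_mult (fun _ => c)), analytic_at_const. Qed.

Lemma analytic_at_minus f g s0 :
  analytic_at f s0 -> analytic_at g s0 -> analytic_at (fun s => f s - g s) s0.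
Proof.
  intros Hf Hg. apply analytic_at_ext with (fun s => f s + (- (1)) * g s); [intros; ring|].
  apply analytic_at_plus; [exact Hf|]. now apply analytic_at_scal.
Qed.

Lemma analytic_at_isometry f alpha beta s0 :
  Cmod alpha = 1%R -> analytic_at f (alpha * s0 + beta) ->
  analytic_at (fun s => f (alpha * s + beta)) s0.
Proof.
  rewrite !analytic_at_majorized. intros Ha [r [B [Hr HB]]]. exists r, B.
  split; [exact Hr|]. now apply majorized_isometry.
Qed.

Lemma analytic_at_Cexp L s0 : analytic_at (fun s => Cexp (s * L)) s0.
Proof.
  apply analytic_at_majorized.
  exists 1%R, (Cmod (Cexp (s0 * L)) * exp (1 * Cmod L))%R. split; [lra|].
  apply majorized_Cexp. lra.
Qed.

Lemma analytic_at_psum (F : nat -> C -> C) n s0 :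
  (forall j, (j < n)%nat -> analytic_at (F j) s0) ->
  analytic_at (fun s => psum (fun j => F j s) n) s0.
Proof.
  induction n as [|n IH]; intros H; simpl.
  - apply analytic_at_const.
  - apply analytic_at_plus; [apply IH; intros; apply H; lia|apply H; lia].
Qed.

Lemma is_Cseries_geom q : (Cmod q <= 1/2)%R -> is_Cseries (fun k => q ^ k) (/ (1 - q)).
Proof.
  intros Hq.
  assert (Hn : 1 - q <> 0).
  { intro E. assert (q = 1) as -> by (replace q with (1 - (1 - q)) by ring; rewrite E; ring).
    rewrite Cmod_1 in Hq. lra. }
  destruct (Cseries_dominated (fun k => q ^ k) (fun k => (1/2)^k)%R 2) as [l [Hl _]].
  - intro n. rewrite Cmod_pow. apply pow_incr. split; [apply Cmod_ge_0|exact Hq].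
  - apply half_powers_partial_sums.
  - apply is_Cseries_value with l; [exact Hl|].
    assert (l = 1 + q * l) as El.
    { apply (is_Cseries_unique _ _ _ Hl).
      pose proof (is_Cseries_shift (fun k => q ^ k) 1 (q * l)) as [Sh _].
      eapply is_Cseries_value; [apply Sh|simpl; ring].
      exact (is_Cseries_scal q _ _ Hl). }
    assert (l * (1 - q) = 1) as E2.
    { replace (l * (1 - q)) with (l - q * l) by ring. rewrite El at 1. ring. }
    replace l with (l * (1 - q) / (1 - q)) by (field; exact Hn). rewrite E2. field. exact Hn.
Qed.

Lemma analytic_at_inv p s0 : s0 <> p -> analytic_at (fun s => / (s - p)) s0.
Proof.
  intros Hp. set (d := s0 - p).
  assert (Hd : d <> 0).
  { intro E. apply Hp. replace s0 with (d + p) by (unfold d; ring). rewrite E. ring. }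
  pose proof (proj1 (Cmod_gt_0 d) Hd) as Hd'.
  apply analytic_at_majorized. exists (Cmod d / 2)%R, (/ Cmod d * 2)%R. split; [lra|].
  exists (fun k => / d * (- / d) ^ k). split.
  - intro n. apply Rle_trans with (rsum (fun k => / Cmod d * (1/2)^k) n)%R.
    + apply rsum_le. intros k _. rewrite Cmod_mult, Cmod_pow, Cmod_opp, Cmod_inv by exact Hd.
      rewrite Rmult_assoc, <- Rpow_mult_distr. right. do 2 f_equal. field. lra.
    + rewrite rsum_scal. apply Rmult_le_compat_l; [left; now apply Rinv_0_lt_compat|].
      apply half_powers_partial_sums.
  - intros s Hs.
    assert (Hq : (Cmod (- / d * (s - s0)) <= 1/2)%R).
    { rewrite Cmod_mult, Cmod_opp, Cmod_inv by exact Hd.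
      apply Rmult_le_reg_l with (Cmod d); [exact Hd'|].
      rewrite <- Rmult_assoc, Rinv_r by lra. lra. }
    eapply is_Cseries_value.
    + eapply is_Cseries_ext; [|exact (is_Cseries_scal (/ d) _ _ (is_Cseries_geom _ Hq))].
      intro k. cbv beta. rewrite Cpow_mult_l. ring.
    + assert (Hs' : s - p <> 0).
      { intro E. replace (s - s0) with (- d) in Hs.
        - rewrite Cmod_opp in Hs. lra.
        - unfold d. replace (s - s0) with (s - p - (s0 - p)) by ring. rewrite E. ring. }
      assert (H1 : d + (s - s0) <> 0).
      { replace (d + (s - s0)) with (s - p) by (unfold d; ring). exact Hs'. }
      replace (s - p) with (d + (s - s0)) by (unfold d; ring). field. now split.
Qed.

(** The first nonzero coefficient would dominate the series close to the
    center. *)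
Lemma analytic_zeros_isolated f p :
  analytic_at f p ->
  (forall eps : R, (0 < eps)%R -> exists q, (0 < Cmod (q - p) < eps)%R /\ f q = 0) ->
  near p (fun s => f s = 0).
Proof.
  rewrite analytic_at_majorized. intros [rho [B [Hr [c [H1 H2]]]]] Hz.
  assert (HB : (0 <= B)%R) by exact (H1 O).
  assert (Hc : forall n, (forall k, (k < n)%nat -> c k = 0) -> c n = 0).
  { intros n Hn. apply NNPP. intro Hcn. apply Cmod_gt_0 in Hcn.
    assert (Hrn : (0 < rho ^ S n)%R) by now apply pow_lt.
    (* at a zero [q] with [x = |q - p|], the terms beyond the n-th one are at
       most [(x / rho) ^ (n + 1) * B], which is too small to cancel
       [c n * (q - p) ^ n] once [x < e] *)
    set (e := (Cmod (c n) * rho ^ S n / (B + 1))%R).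
    assert (He : (0 < e)%R).
    { unfold e. apply Rdiv_lt_0_compat; [now apply Rmult_lt_0_compat|lra]. }
    destruct (Hz (Rmin e rho)) as [q [[Hq0 Hq] Hfq]]; [now apply Rmin_pos|].
    pose proof (Rmin_l e rho). pose proof (Rmin_r e rho).
    set (x := Cmod (q - p)) in *.
    specialize (H2 q ltac:(fold x; lra)). rewrite Hfq in H2.
    assert (Hxn : (0 < x ^ n)%R) by now apply pow_lt.
    assert (Hps : psum (fun k => c k * (q - p) ^ k) (S n) = c n * (q - p) ^ n).
    { simpl. replace (psum (fun k => c k * (q - p) ^ k) n) with (RtoC 0); [ring|].
      clear -Hn. induction n as [|n IH]; [reflexivity|]. simpl.
      rewrite <- IH by (intros; apply Hn; lia). rewrite Hn by lia. ring. }
    assert (Ht : is_Cseries (fun k => c (S n + k)%nat * (q - p) ^ (S n + k)) (- (c n * (q - p) ^ n))).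
    { apply (is_Cseries_shift (fun k => c k * (q - p) ^ k)). rewrite Hps.
      eapply is_Cseries_value; [exact H2|ring]. }
    assert (Hle : (Cmod (c n) * x ^ n <= (x / rho) ^ S n * B)%R).
    { replace (Cmod (c n) * x ^ n)%R with (Cmod (- (c n * (q - p) ^ n)))
        by (rewrite Cmod_opp, Cmod_mult, Cmod_pow; reflexivity).
      apply (Cseries_limit_le _ _ _ O Ht). intros m _.
      eapply Rle_trans; [apply Cmod_psum_le|].
      apply Rle_trans with (rsum (fun k => (x / rho) ^ S n * (Cmod (c (S n + k)%nat) * rho ^ (S n + k))) m)%R.
      - apply rsum_le. intros k _. rewrite Cmod_mult, Cmod_pow. fold x.
        replace (x ^ (S n + k))%R with ((x / rho) ^ (S n + k) * rho ^ (S n + k))%R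
          by (rewrite <- Rpow_mult_distr; f_equal; field; lra).
        assert ((x / rho) ^ (S n + k) <= (x / rho) ^ S n)%R.
        { rewrite pow_add. rewrite <- (Rmult_1_r ((x / rho) ^ S n)) at 2.
          assert (0 <= x / rho <= 1)%R.
          { split; [apply Rdiv_le_0_compat; lra|]. apply Rmult_le_reg_r with rho; [lra|].
            unfold Rdiv. rewrite Rmult_assoc, Rinv_l by lra. lra. }
          apply Rmult_le_compat_l; [apply pow_le; lra|].
          rewrite <- (pow1 k). apply pow_incr. lra. }
        assert (0 <= Cmod (c (S n + k)%nat) * rho ^ (S n + k))%R.
        { apply Rmult_le_pos; [apply Cmod_ge_0|apply pow_le; lra]. }
        rewrite (Rmult_comm ((x / rho) ^ (S n + k))), <- Rmult_assoc, Rmult_comm.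
        apply Rmult_le_compat_r; assumption.
      - rewrite rsum_scal. apply Rmult_le_compat_l.
        + apply pow_le. apply Rdiv_le_0_compat; lra.
        + specialize (H1 (S n + m)%nat). rewrite rsum_add in H1.
          pose proof (rsum_nonneg (fun k => Cmod (c k) * rho ^ k)%R (S n)) as H4.
          specialize (H4 ltac:(intro; apply Rmult_le_pos; [apply Cmod_ge_0|apply pow_le; lra])).
          lra. }
    unfold Rdiv in Hle. rewrite Rpow_mult_distr, pow_inv in Hle. simpl (x ^ S n)%R in Hle.
    assert (Cmod (c n) * rho ^ S n <= x * B)%R.
    { apply Rmult_le_reg_l with (x ^ n * / rho ^ S n)%R.
      - apply Rmult_lt_0_compat; [exact Hxn|now apply Rinv_0_lt_compat].
      - apply Rle_trans with (Cmod (c n) * x ^ n)%R; [right; field; lra|lra]. }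
    assert (x * (B + 1) < Cmod (c n) * rho ^ S n)%R.
    { replace (Cmod (c n) * rho ^ S n)%R with (e * (B + 1))%R by (unfold e; field; lra).
      apply Rmult_lt_compat_r; lra. }
    lra. }
  assert (Hall : forall n, c n = 0).
  { intro n. induction n as [n IH] using (well_founded_induction Wf_nat.lt_wf). now apply Hc. }
  exists rho. split; [exact Hr|]. intros s Hs. specialize (H2 s ltac:(lra)).
  apply (is_Cseries_unique _ _ _ H2).
  eapply is_Cseries_value; [apply (is_Cseries_finite _ O)|reflexivity].
  intros k _. rewrite Hall. ring.
Qed.

(** The set of parameters up to which [f] vanishes near the segment is open and
    closed: at its supremum, zeros accumulate. *)
Lemma analytic_zero_along_segment f p q :
  (forall t : R, (0 <= t <= 1)%R -> analytic_at f (p + t * (q - p))) ->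
  near p (fun s => f s = 0) -> f q = 0.
Proof.
  intros Ha Hp.
  assert (Hself : forall x, near x (fun s => f s = 0) -> f x = 0).
  { intros x [d [Hd H]]. apply H. replace (x - x) with (RtoC 0) by ring. now rewrite Cmod_0. }
  destruct (classic (q - p = 0)) as [E|Hpq].
  { replace q with p; [now apply Hself|]. replace q with (p + (q - p)) by ring. rewrite E. ring. }
  apply Cmod_gt_0 in Hpq.
  set (g := fun t : R => p + t * (q - p)).
  assert (Hg : forall t t' : R, Cmod (g t - g t') = (Rabs (t - t') * Cmod (q - p))%R).
  { intros t t'. unfold g.
    replace (p + t * (q - p) - (p + t' * (q - p))) with (RtoC (t - t') * (q - p))
      by (rewrite RtoC_minus; ring).
    now rewrite Cmod_mult, Cmod_R. }
  set (E := fun t => (0 <= t <= 1)%R /\ forall t', (0 <= t' <= t)%R -> near (g t') (fun s => f s = 0)).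
  assert (E0 : E 0%R).
  { split; [lra|]. intros t' Ht'. replace t' with 0%R by lra. unfold g.
    replace (p + 0 * (q - p)) with p by ring. exact Hp. }
  destruct (completeness E) as [l [Hub Hlub]].
  { exists 1%R. intros t [Ht _]. lra. }
  { now exists 0%R. }
  assert (Hl : (0 <= l <= 1)%R).
  { split; [now apply Hub|]. apply Hlub. intros t [Ht _]. lra. }
  assert (Hnear : near (g l) (fun s => f s = 0)).
  { destruct (Rle_lt_or_eq_dec 0 l ltac:(lra)) as [Hl0|<-]; [|apply E0; lra].
    apply analytic_zeros_isolated; [now apply Ha|]. intros eps He.
    set (d := Rmin (eps / 2 / Cmod (q - p)) (l / 2)).
    assert (Hd : (0 < d)%R) by (apply Rmin_pos; [repeat apply Rdiv_lt_0_compat; lra|lra]).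
    assert (Hd1 : (d * Cmod (q - p) <= eps / 2)%R).
    { apply Rmult_le_reg_r with (/ Cmod (q - p))%R; [now apply Rinv_0_lt_compat|].
      rewrite Rmult_assoc, Rinv_r by lra. rewrite Rmult_1_r. apply Rmin_l. }
    assert (Hd2 : (d <= l / 2)%R) by apply Rmin_r.
    exists (g (l - d)%R). split.
    - rewrite Hg. replace (l - d - l)%R with (- d)%R by ring. rewrite Rabs_Ropp, Rabs_pos_eq by lra.
      split; [now apply Rmult_lt_0_compat|lra].
    - apply Hself. assert (exists t, E t /\ (l - d < t)%R) as [t [[_ Ht] Hlt]].
      { apply NNPP. intro Hn. assert (l <= l - d)%R; [|lra].
        apply Hlub. intros t Ht. apply Rnot_lt_le. intro. apply Hn. now exists t. }
      apply Ht. lra. }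
  destruct Hnear as [d [Hd Hz]].
  assert (Hloc : forall t, (Rabs (t - l) * Cmod (q - p) < d / 2)%R -> near (g t) (fun s => f s = 0)).
  { intros t Ht. exists (d / 2)%R. split; [lra|]. intros s Hs. apply Hz.
    pose proof (Cmod_triangle3 s (g t) (g l)) as T. rewrite Hg in T. lra. }
  set (e := (d / 4 / Cmod (q - p))%R).
  assert (He : (0 < e)%R) by (unfold e; repeat apply Rdiv_lt_0_compat; lra).
  assert (Hee : (e * Cmod (q - p) = d / 4)%R) by (unfold e; field; lra).
  assert (HE : E (Rmin 1 (l + e))).
  { pose proof (Rmin_l 1 (l + e)). pose proof (Rmin_r 1 (l + e)).
    split; [split; [apply Rmin_glb; lra|lra]|].
    intros t' Ht'. destruct (Rlt_le_dec t' (l - e)) as [Hlt|Hge].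
    - assert (exists t, E t /\ (l - e < t)%R) as [t [[_ Ht] Hlt2]].
      { apply NNPP. intro Hn. assert (l <= l - e)%R; [|lra].
        apply Hlub. intros t Ht. apply Rnot_lt_le. intro. apply Hn. now exists t. }
      apply Ht. lra.
    - apply Hloc. apply Rle_lt_trans with (e * Cmod (q - p))%R; [|lra].
      apply Rmult_le_compat_r; [lra|]. apply Rabs_le. lra. }
  assert (l = 1%R) as ->.
  { pose proof (Hub _ HE). unfold Rmin in H. destruct (Rle_dec 1 (l + e)); lra. }
  replace q with (g 1%R) by (unfold g; ring).
  apply Hself. destruct HE as [_ HE]. apply HE. rewrite Rmin_left by lra. lra.
Qed.

Lemma analytic_eq_along_segment f g p q :
  (forall t : R, (0 <= t <= 1)%R ->
     analytic_at f (p + t * (q - p)) /\ analytic_at g (p + t * (q - p))) ->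
  near p (fun s => f s = g s) -> f q = g q.
Proof.
  intros Ha [d [Hd Hp]].
  assert (f q - g q = 0) as E.
  { apply (analytic_zero_along_segment (fun s => f s - g s) p q).
    - intros t Ht. apply analytic_at_minus; now apply Ha.
    - exists d. split; [exact Hd|]. intros s Hs. rewrite Hp by exact Hs. ring. }
  replace (f q) with (f q - g q + g q) by ring. rewrite E. ring.
Qed.

Lemma near_Re_gt p (x : R) : (x < Re p)%R -> near p (fun s => (x < Re s)%R).
Proof.
  intros H. exists (Re p - x)%R. split; [lra|]. intros s Hs.
  pose proof (re_le_Cmod (s - p)) as T. unfold Re in *. simpl in T.
  unfold Rabs in T. destruct (Rcase_abs (fst s + - fst p)); lra.
Qed.

Lemma near_imp p (P Q : C -> Prop) : (forall s, P s -> Q s) -> near p P -> near p Q.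
Proof. intros H [d [Hd K]]. exists d. split; [exact Hd|]. intros s Hs. apply H, K, Hs. Qed.

Lemma analytic_eq_half_plane f g (x : R) :
  (forall s, (x < Re s)%R -> analytic_at f s /\ analytic_at g s) ->
  (forall s, (1 < Re s)%R -> f s = g s) ->
  forall s, (x < Re s)%R -> f s = g s.
Proof.
  intros Ha He s Hs. apply (analytic_eq_along_segment f g (s + RtoC (2 + Rabs (Re s)))).
  - intros t Ht. apply Ha. unfold Re in *. simpl.
    pose proof (Rabs_pos (fst s)). nra.
  - eapply near_imp; [exact He|]. apply near_Re_gt. unfold Re. simpl.
    pose proof (Rle_abs (- fst s)) as T. rewrite Rabs_Ropp in T. lra.
Qed.

(** A segment ending at [s] and starting off the real axis in the half plane
    [Re s > 1] avoids the point 1, except possibly at its end. *)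
Lemma analytic_eq_except_one f g (Q : C -> Prop) :
  (forall s : C, s <> 1 -> Q s) ->
  (forall s, Q s -> analytic_at f s /\ analytic_at g s) ->
  (forall s, (1 < Re s)%R -> f s = g s) ->
  forall s, Q s -> f s = g s.
Proof.
  intros HQ Ha He s Hs.
  set (h := if Req_EM_T (Im s) 0 then 1%R else Im s).
  assert (Hh : (h <> 0 /\ (Im s = 0 \/ Im s = h))%R).
  { unfold h. destruct (Req_EM_T (Im s) 0); split; auto; lra. }
  apply (analytic_eq_along_segment f g (2%R, h)).
  - intros t Ht. apply Ha.
    destruct (Req_EM_T t 1) as [->|Ht1].
    + replace ((2%R, h) + 1 * (s - (2%R, h))) with s by ring. exact Hs.
    + apply HQ. intro E. apply (f_equal snd) in E. simpl in E. unfold Im in Hh.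
      destruct Hh as [H0 [H1|H1]]; rewrite H1 in E.
      * assert (E' : (h * (1 - t) = 0)%R) by lra. apply Rmult_integral in E'. lra.
      * lra.
  - eapply near_imp; [exact He|]. apply near_Re_gt. simpl. lra.
Qed.

(** * The principal logarithm and the binomial series *)

Lemma Re_le_Cmod_div (w : C) : w <> 0 -> (-1 <= Re w / Cmod w <= 1)%R.
Proof.
  intros Hw. apply Cmod_gt_0 in Hw.
  pose proof (re_le_Cmod w) as H. apply Rabs_le_between in H.
  split; apply Rmult_le_reg_r with (Cmod w); try lra;
  unfold Rdiv; rewrite Rmult_assoc, Rinv_l by lra; lra.
Qed.

Lemma sqrt_one_minus_Re (w : C) : w <> 0 ->
  sqrt (1 - (Re w / Cmod w)²) = (Rabs (Im w) / Cmod w)%R.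
Proof.
  intros Hw. apply Cmod_gt_0 in Hw.
  replace (1 - (Re w / Cmod w)²)%R with ((Im w / Cmod w)²).
  - rewrite sqrt_Rsqr_abs. unfold Rdiv. rewrite Rabs_mult. f_equal.
    apply Rabs_pos_eq. left. now apply Rinv_0_lt_compat.
  - pose proof (Cmod2_alt w) as H. unfold Rsqr.
    assert (E : (Im w * Im w = Cmod w * Cmod w - Re w * Re w)%R) by lra.
    replace (Im w / Cmod w * (Im w / Cmod w))%R with ((Im w * Im w) / (Cmod w * Cmod w))%R by (field; lra).
    rewrite E. field. lra.
Qed.

Lemma Cexp_Clog (w : C) : w <> 0 -> Cexp (Clog w) = w.
Proof.
  intros Hw. pose proof (Re_le_Cmod_div w Hw) as Hb.
  pose proof (sqrt_one_minus_Re w Hw) as Hs.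
  pose proof (proj1 (Cmod_gt_0 w) Hw) as Hp.
  unfold Cexp, Clog, Carg, Re, Im in *. simpl. rewrite exp_ln by exact Hp.
  destruct (Rlt_dec (snd w) 0) as [Hi|Hi].
  - rewrite cos_neg, sin_neg, cos_acos, sin_acos, Hs by exact Hb.
    rewrite Rabs_left by exact Hi. apply C_ext; simpl; field; lra.
  - rewrite cos_acos, sin_acos, Hs by exact Hb.
    rewrite Rabs_pos_eq by lra. apply C_ext; simpl; field; lra.
Qed.

Lemma Clog_scale (x : R) (w : C) : (0 < x)%R -> w <> 0 -> Clog (x * w) = ln x + Clog w.
Proof.
  intros Hx Hw. apply Cmod_gt_0 in Hw.
  assert (E : Cmod (x * w) = (x * Cmod w)%R).
  { rewrite Cmod_mult, Cmod_R, Rabs_pos_eq; lra. }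
  assert (E1 : Re (x * w) = (x * Re w)%R) by (unfold Re; simpl; ring).
  assert (E2 : Im (x * w) = (x * Im w)%R) by (unfold Im; simpl; ring).
  unfold Clog. apply C_ext; simpl.
  - rewrite E, ln_mult; lra.
  - rewrite Rplus_0_l. unfold Carg. rewrite E, E1, E2.
    replace (x * Re w / (x * Cmod w))%R with (Re w / Cmod w)%R by (field; lra).
    destruct (Rlt_dec (x * Im w) 0), (Rlt_dec (Im w) 0); try reflexivity; exfalso; nra.
Qed.

Lemma Carg_bound w : (Rabs (Carg w) <= PI)%R.
Proof.
  unfold Carg. pose proof (acos_bound (Re w / Cmod w)).
  destruct (Rlt_dec (Im w) 0); [rewrite Rabs_Ropp|]; rewrite Rabs_pos_eq; lra.
Qed.

Lemma Carg_right w : (0 < Re w)%R -> Carg w = atan (Im w / Re w).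
Proof.
  intros Hr. assert (Hw : w <> 0) by (intros ->; unfold Re in Hr; simpl in Hr; lra).
  pose proof (sqrt_one_minus_Re w Hw) as Hs. apply Cmod_gt_0 in Hw.
  unfold Carg. rewrite acos_atan by (apply Rdiv_lt_0_compat; lra). rewrite Hs.
  destruct (Rlt_dec (Im w) 0) as [Hi|Hi].
  - rewrite Rabs_left by exact Hi. rewrite <- atan_opp. f_equal. field. lra.
  - rewrite Rabs_pos_eq by lra. f_equal. field. lra.
Qed.

Lemma Cmod_Clog_le w : (1 <= Cmod w)%R -> (Cmod (Clog w) <= ln (Cmod w) + PI)%R.
Proof.
  intros H. unfold Clog.
  replace ((ln (Cmod w), Carg w) : C) with (RtoC (ln (Cmod w)) + Ci * RtoC (Carg w))
    by (apply C_ext; simpl; ring).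
  eapply Rle_trans; [apply Cmod_triangle|].
  rewrite Cmod_mult, Cmod_Ci, !Cmod_R, Rmult_1_l.
  apply Rplus_le_compat; [|apply Carg_bound].
  rewrite Rabs_pos_eq; [lra|]. rewrite <- ln_1. apply ln_le; lra.
Qed.

Fixpoint Cbinom (w : C) (r : nat) : C :=
  match r with
  | O => 1
  | S q => Cbinom w q * ((w - RtoC (INR q)) / RtoC (INR (S q)))
  end.

(** Each factor [(w - q) / (q + 1)] is at most [|w| + 1] in absolute value; this
    crude bound dominates the binomial series by a geometric one for large
    [|a|]. *)
Lemma majorized_Cbinom w0 rho r : (0 < rho)%R ->
  majorized (fun w => Cbinom w r) w0 rho ((Cmod w0 + rho + 1) ^ r).
Proof.
  intros Hr. induction r as [|r IH].
  - apply majorized_weaken with (Cmod 1); [rewrite Cmod_1; simpl; lra|now apply majorized_const].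
  - pose proof (lt_0_INR (S r) ltac:(lia)) as Hp. pose proof (Cmod_ge_0 w0).
    simpl pow. rewrite Rmult_comm. apply majorized_mult; [exact Hr|exact IH|].
    apply majorized_weaken with (Cmod (/ RtoC (INR (S r))) * ((Cmod w0 + rho) + Cmod (- RtoC (INR r))))%R.
    + rewrite Cmod_inv by (apply RtoC_neq_0; lra). rewrite Cmod_opp, !Cmod_R.
      rewrite !Rabs_pos_eq by (apply pos_INR || lra).
      apply Rmult_le_reg_l with (INR (S r)); [exact Hp|].
      rewrite <- Rmult_assoc, Rinv_r by lra. rewrite S_INR. pose proof (pos_INR r). nra.
    + apply majorized_ext with (fun w => / RtoC (INR (S r)) * (w + - RtoC (INR r))).
      * intros. field. apply RtoC_neq_0. lra.
      * apply majorized_scal. apply majorized_plus; [exact Hr|now apply majorized_id|now apply majorized_const].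
Qed.

Lemma Cbinom_bound w r (M : R) : (Cmod w + 1 <= M)%R -> (Cmod (Cbinom w r) <= M ^ r)%R.
Proof.
  intros HM. pose proof (Cmod_ge_0 w).
  induction r as [|r IH]; [simpl; rewrite Cmod_1; lra|].
  pose proof (lt_0_INR (S r) ltac:(lia)) as Hp.
  cbn [Cbinom pow]. rewrite Cmod_mult, Rmult_comm.
  apply Rmult_le_compat; try apply Cmod_ge_0; [|exact IH].
  rewrite Cmod_div by (apply RtoC_neq_0; lra). rewrite Cmod_R, (Rabs_pos_eq (INR (S r))) by lra.
  apply Rmult_le_reg_r with (INR (S r)); [exact Hp|].
  unfold Rdiv. rewrite Rmult_assoc, Rinv_l by lra.
  pose proof (Cmod_triangle w (- RtoC (INR r))) as T. rewrite Cmod_opp, Cmod_R in T.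
  rewrite (Rabs_pos_eq (INR r)) in T by apply pos_INR.
  change (w - RtoC (INR r)) with (w + - RtoC (INR r)).
  rewrite S_INR in *. pose proof (pos_INR r). nra.
Qed.

Lemma Cbinom_analytic r s0 : analytic_at (fun w => Cbinom w r) s0.
Proof.
  apply analytic_at_majorized. exists 1%R, ((Cmod s0 + 1 + 1) ^ r)%R. split; [lra|].
  apply majorized_Cbinom. lra.
Qed.

(** Newton's binomial series.  Along the segment from [a] to [a + 1] in the
    right half plane, [L t = w * Clog (a + t)] satisfies
    [(1 + t / a) L' = w / a], which is the recursion of the coefficients. *)
Lemma binomial_series a w : (0 < Re a)%R -> (2 * (Cmod w + 1) <= Cmod a)%R ->
  is_Cseries (fun r => Cpower a w * (Cbinom w r * (/ a) ^ r)) (Cpower (a + 1) w).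
Proof.
  intros Ha Hw. pose proof (Cmod_ge_0 w) as Hw0.
  assert (Ha0 : a <> 0) by (intros ->; unfold Re in Ha; simpl in Ha; lra).
  destruct a as [x y]. unfold Re in Ha; simpl in Ha.
  set (a := (x, y)) in *.
  (* real and imaginary parts of [Clog (a + t)] in differentiable form *)
  set (lam := fun t : R => (/ 2 * ln ((x + t) ^ 2 + y ^ 2))%R).
  set (th := fun t : R => atan (y / (x + t))).
  assert (HL : forall t : R, (0 <= t)%R -> Clog (a + t) = (lam t, th t)).
  { intros t Ht. unfold Clog. f_equal.
    - unfold lam. assert (E : Cmod (a + t) = sqrt ((x + t) ^ 2 + y ^ 2)).
      { unfold Cmod. simpl. f_equal. ring. }
      rewrite E.
      assert (0 < (x + t) ^ 2 + y ^ 2)%R by nra.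
      rewrite <- (sqrt_sqrt ((x + t) ^ 2 + y ^ 2)) at 2 by lra.
      rewrite ln_mult by now apply sqrt_lt_R0. field.
    - rewrite Carg_right; unfold Re, Im; simpl; [|lra]. unfold th. f_equal. f_equal. ring. }
  assert (Hat : forall t : R, (0 <= t)%R -> a + t <> 0).
  { intros t Ht E. apply (f_equal fst) in E. simpl in E. lra. }
  eapply is_Cseries_value.
  - apply (is_Cseries_scal (Cpower a w)).
    apply (Cseries_linear_ode (fun r => Cbinom w r * (/ a) ^ r) (/ a) (w / a)
      (fun t => fst w * lam t - snd w * th t)%R (fun t => fst w * th t + snd w * lam t)%R 1).
    + intro k. rewrite Cmod_mult, Cmod_pow, Cmod_inv by exact Ha0.
      apply Cmod_gt_0 in Ha0.
      apply Rle_trans with ((Cmod w + 1) ^ k * (/ Cmod a) ^ k * 2 ^ k)%R.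
      * apply Rmult_le_compat_r; [apply pow_le; lra|].
        apply Rmult_le_compat_r; [apply pow_le; left; now apply Rinv_0_lt_compat|].
        apply Cbinom_bound. lra.
      * rewrite <- !Rpow_mult_distr. apply Rle_trans with (1 ^ k)%R; [|rewrite pow1; lra].
        apply pow_incr.
        pose proof (Rinv_0_lt_compat _ Ha0).
        split; [repeat apply Rmult_le_pos; lra|].
        apply Rmult_le_reg_l with (Cmod a); [exact Ha0|].
        replace (Cmod a * ((Cmod w + 1) * / Cmod a * 2))%R with (2 * (Cmod w + 1))%R by (field; lra).
        lra.
    + intro k. cbn [Cbinom Cpow]. pose proof (lt_0_INR (S k) ltac:(lia)) as Hp.
      field. split; [exact Ha0|]. apply RtoC_neq_0. lra.
    + intros t Ht E. apply (Hat t); [lra|].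
      replace (a + t) with (a * (1 + / a * t)) by (field; exact Ha0). rewrite E. ring.
    + intros t Ht. set (D := ((x + t) ^ 2 + y ^ 2)%R).
      assert (HD : (0 < D)%R) by (unfold D; nra).
      assert (Dl : is_derive lam t ((x + t) / D)%R).
      { unfold lam. auto_derive; [nra|]. fold D. unfold D in *. field.
        nra. }
      assert (Dt : is_derive th t (- y / D)%R).
      { unfold th. auto_derive; [lra|]. unfold D in *. field. split; [nra|]. lra. }
      pose proof (is_derive_unique _ _ _ Dl) as Ul. pose proof (is_derive_unique _ _ _ Dt) as Ut.
      exists (fst w * ((x + t) / D) - snd w * (- y / D))%R, (fst w * (- y / D) + snd w * ((x + t) / D))%R.
      split; [|split].
      * auto_derive; [repeat split; [now eexists; exact Dl|now eexists; exact Dt]|].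
        change (Derive (fun x => lam x) t) with (Derive lam t).
        change (Derive (fun x => th x) t) with (Derive th t). rewrite Ul, Ut. ring.
      * auto_derive; [repeat split; [now eexists; exact Dt|now eexists; exact Dl]|].
        change (Derive (fun x => lam x) t) with (Derive lam t).
        change (Derive (fun x => th x) t) with (Derive th t). rewrite Ul, Ut. ring.
      * transitivity (w * / (a + t) * (1 + / a * t)).
        -- f_equal. apply C_ext; simpl; unfold D; field; nra.
        -- field. split; [exact Ha0|apply Hat; lra].
  - cbn [Cbinom Cpow]. unfold Cpower.
    rewrite !Cmult_1_l, <- Cexp_plus. f_equal.
    assert (E1 : Clog (a + 1) = (lam 1%R, th 1%R)) by (apply HL; lra).
    assert (E0 : Clog a = (lam 0%R, th 0%R)).
    { replace a with (a + 0) by ring. apply HL; lra. }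
    rewrite E1, E0. apply C_ext; simpl; ring.
Qed.


Lemma exp_le_mono x y : (x <= y)%R -> (exp x <= exp y)%R.
Proof. intros [H| ->]; [left; now apply exp_increasing|right; reflexivity]. Qed.

(** The left side is the norm of [w |-> Cpower a w] on the disc of center [w0]
    and radius [rho]; the argument of [a] only contributes a constant. *)
Lemma Cpower_majorant_le a w0 (rho : R) : (1 <= Cmod a)%R -> (0 <= rho)%R ->
  (Cmod (Cexp (w0 * Clog a)) * exp (rho * Cmod (Clog a)) <=
   exp ((Cmod w0 + rho) * PI) * exp ((Re w0 + rho) * ln (Cmod a)))%R.
Proof.
  intros Ha Hr. rewrite Cmod_Cexp, <- !exp_plus. apply exp_le_mono.
  pose proof (Cmod_Clog_le a Ha) as HL. pose proof (Carg_bound a) as HA.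
  assert (E : Re (w0 * Clog a) = (Re w0 * ln (Cmod a) - Im w0 * Carg a)%R) by reflexivity.
  rewrite E.
  assert (- (Im w0 * Carg a) <= Cmod w0 * PI)%R.
  { eapply Rle_trans; [apply Rle_abs|]. rewrite Rabs_Ropp, Rabs_mult.
    apply Rmult_le_compat; try apply Rabs_pos; [|exact HA].
    eapply Rle_trans; [|apply Rmax_Cmod]. apply Rmax_r. }
  assert (rho * Cmod (Clog a) <= rho * (ln (Cmod a) + PI))%R by now apply Rmult_le_compat_l.
  lra.
Qed.

Lemma geometric_tail_le (q : R) N n : (0 <= q <= 1/2)%R ->
  (rsum (fun k => q ^ (N + k)) n <= 2 * q ^ N)%R.
Proof.
  intros Hq. assert (HR : (0 <= q ^ N)%R) by (apply pow_le; lra).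
  apply Rle_trans with (rsum (fun k => q ^ N * (1/2) ^ k) n)%R.
  - apply rsum_le. intros k _. rewrite pow_add. apply Rmult_le_compat_l; [exact HR|].
    now apply pow_incr.
  - rewrite rsum_scal, Rmult_comm. apply Rmult_le_compat_r; [exact HR|].
    apply half_powers_partial_sums.
Qed.

(** * Analyticity of the remainder series *)

Definition binomial_remainder (a : C) (N : nat) (w : C) : C :=
  Cpower (a + 1) w - Cpower a w * psum (fun r => Cbinom w r * (/ a) ^ r) N.

(** What matters is the exponent [Re w0 + rho - N] of [|a|]: every further term
    of the expansion gains one power of [|a|]. *)
Lemma majorized_binomial_remainder a N w0 (rho : R) :
  (0 < rho)%R -> (0 < Re a)%R -> (1 <= Cmod a)%R -> (2 * (Cmod w0 + rho + 1) <= Cmod a)%R ->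
  majorized (binomial_remainder a N) w0 rho
    (2 * (Cmod w0 + rho + 1) ^ N * exp ((Cmod w0 + rho) * PI) *
     exp ((Re w0 + rho - INR N) * ln (Cmod a))).
Proof.
  intros Hr Ha Ha1 HaM. set (M := (Cmod w0 + rho + 1)%R) in *.
  pose proof (Cmod_ge_0 w0) as Hw0. pose proof PI_RGT_0 as HPI.
  assert (Ha0 : a <> 0) by (intros ->; unfold Re in Ha; simpl in Ha; lra).
  set (q := (M * / Cmod a)%R).
  assert (Hq : (0 <= q <= 1/2)%R).
  { pose proof (Rinv_0_lt_compat (Cmod a) ltac:(lra)). unfold q. split.
    - apply Rmult_le_pos; [unfold M|]; lra.
    - apply Rmult_le_reg_r with (Cmod a); [lra|]. rewrite Rmult_assoc, Rinv_l by lra. lra. }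
  set (A := (Cmod (Cexp (w0 * Clog a)) * exp (rho * Cmod (Clog a)))%R).
  assert (HA : (0 <= A)%R).
  { apply Rmult_le_pos; [apply Cmod_ge_0|left; apply exp_pos]. }
  apply majorized_weaken with (A * (2 * q ^ N))%R.
  - pose proof (Cpower_majorant_le a w0 rho Ha1 ltac:(lra)) as H. fold A in H.
    assert (0 <= 2 * q ^ N)%R by (apply Rmult_le_pos; [lra|apply pow_le; lra]).
    eapply Rle_trans; [apply Rmult_le_compat_r; [assumption|exact H]|].
    right. unfold q. rewrite Rpow_mult_distr, pow_inv.
    replace ((Re w0 + rho - INR N) * ln (Cmod a))%R with
      ((Re w0 + rho) * ln (Cmod a) + - (INR N * ln (Cmod a)))%R by ring.
    rewrite exp_plus, exp_Ropp.
    replace (exp (INR N * ln (Cmod a))) with (Cmod a ^ N)%R.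
    + field. apply pow_nonzero. lra.
    + rewrite <- Rpower_pow by lra. reflexivity.
  - apply (majorized_series _ _ Hr
      (fun k w => Cpower a w * ((/ a) ^ (N + k) * Cbinom w (N + k))) _ (fun k => A * q ^ (N + k))%R).
    + intro k. apply majorized_mult; [exact Hr|now apply majorized_Cexp|].
      apply majorized_weaken with (Cmod ((/ a) ^ (N + k)) * M ^ (N + k))%R.
      * right. rewrite Cmod_pow, Cmod_inv by exact Ha0. unfold q.
        rewrite Rpow_mult_distr. ring.
      * apply majorized_scal. now apply majorized_Cbinom.
    + intro n. rewrite rsum_scal. apply Rmult_le_compat_l; [exact HA|].
      now apply geometric_tail_le.
    + intros w Hw.
      assert (HwM : (Cmod w + 1 <= M)%R).
      { pose proof (Cmod_triangle (w - w0) w0) as T.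
        replace (w - w0 + w0) with w in T by ring. unfold M. lra. }
      pose proof (binomial_series a w Ha ltac:(lra)) as Hb.
      apply is_Cseries_ext with (fun k => Cpower a w * (Cbinom w (N + k) * (/ a) ^ (N + k))).
      * intro k. cbv beta. rewrite (Cmult_comm ((/ a) ^ (N + k))). reflexivity.
      * apply (is_Cseries_shift (fun r => Cpower a w * (Cbinom w r * (/ a) ^ r)) N).
        eapply is_Cseries_value; [exact Hb|]. unfold binomial_remainder.
        replace (psum (fun r => Cpower a w * (Cbinom w r * (/ a) ^ r)) N) with
          (Cpower a w * psum (fun r => Cbinom w r * (/ a) ^ r) N); [ring|].
        clear. induction N as [|N IH]; simpl; [ring|rewrite <- IH; ring].
Qed.

(** [(x - 1) * y ^ (- x)] is at most [(y - 1) ^ (1 - x) - y ^ (1 - x)], and these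
    differences telescope. *)
Lemma zeta_partial_sums (x : R) n : (1 < x)%R ->
  (rsum (fun j => exp (- x * ln (INR (S j)))) n <= x / (x - 1))%R.
Proof.
  intros Hx.
  assert (Hstep : forall y, (2 <= y)%R ->
    ((x - 1) * exp (- x * ln y) <= exp ((1 - x) * ln (y - 1)) - exp ((1 - x) * ln y))%R).
  { intros y Hy.
    assert (Hl : (ln (y - 1) <= ln y - / y)%R).
    { assert (E : (y - 1 = y * (1 - / y))%R) by (field; lra).
      assert (Hi : (0 < / y <= / 2)%R).
      { split; [apply Rinv_0_lt_compat; lra|apply Rinv_le_contravar; lra]. }
      rewrite E, ln_mult by lra.
      pose proof (exp_ineq1_le (- / y)) as H.
      assert (ln (1 - / y) <= - / y)%R; [|lra].
      rewrite <- (ln_exp (- / y)). apply ln_le; lra. }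
    assert (H1 : (exp ((1 - x) * ln y) * (1 + (x - 1) * / y) <= exp ((1 - x) * ln (y - 1)))%R).
    { apply Rle_trans with (exp ((1 - x) * ln y) * exp ((x - 1) * / y))%R.
      - apply Rmult_le_compat_l; [left; apply exp_pos|apply exp_ineq1_le].
      - rewrite <- exp_plus. apply exp_le_mono. nra. }
    assert (H2 : (exp (- x * ln y) = exp ((1 - x) * ln y) * / y)%R).
    { replace (- x * ln y)%R with ((1 - x) * ln y + - ln y)%R by ring.
      rewrite exp_plus, exp_Ropp, exp_ln by lra. reflexivity. }
    rewrite H2. lra. }
  assert (Hind : forall n, (rsum (fun j => exp (- x * ln (INR (S j)))) (S n) <=
     1 + / (x - 1) * (1 - exp ((1 - x) * ln (INR (S n)))))%R).
  { clear n. intro n. induction n as [|n IH].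
    - simpl. rewrite ln_1, !Rmult_0_r, exp_0. lra.
    - change (rsum (fun j => exp (- x * ln (INR (S j)))) (S (S n))) with
        (rsum (fun j => exp (- x * ln (INR (S j)))) (S n) + exp (- x * ln (INR (S (S n)))))%R.
      pose proof (Hstep (INR (S (S n)))) as H.
      assert (HS : (INR (S (S n)) - 1 = INR (S n))%R) by (rewrite (S_INR (S n)); ring).
      rewrite HS in H. specialize (H ltac:(rewrite !S_INR; pose proof (pos_INR n); lra)).
      assert (Hi : (0 < / (x - 1))%R) by (apply Rinv_0_lt_compat; lra).
      apply Rmult_le_compat_l with (r := (/ (x - 1))%R) in H; [|lra].
      rewrite <- Rmult_assoc, Rinv_l, Rmult_1_l in H by lra. lra. }
  assert (Hx1 : (x / (x - 1) = 1 + / (x - 1))%R) by (field; lra).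
  assert (Hi : (0 < / (x - 1))%R) by (apply Rinv_0_lt_compat; lra).
  destruct n as [|n]; [simpl; rewrite Hx1; lra|].
  eapply Rle_trans; [apply Hind|]. rewrite Hx1.
  pose proof (exp_pos ((1 - x) * ln (INR (S n)))). nra.
Qed.

Lemma shift_eventually (v : C) (A : R) : exists J, forall j, (J <= j)%nat ->
  (0 < Re (v + INR j) /\ A <= Cmod (v + INR j) /\ INR (S j) / 2 <= Cmod (v + INR j))%R.
Proof.
  destruct (INR_unbounded (2 * Cmod v + Rabs A + 1)) as [J HJ]. exists J. intros j Hj.
  apply le_INR in Hj. pose proof (Cmod_ge_0 v) as H0. pose proof (Rle_abs A).
  pose proof (re_le_Cmod v) as Hv. apply Rabs_le_between in Hv.
  assert (HR : (INR j - Cmod v <= Re (v + INR j))%R).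
  { unfold Re in *. simpl. lra. }
  assert (HC : (Re (v + INR j) <= Cmod (v + INR j))%R).
  { eapply Rle_trans; [apply Rle_abs|apply re_le_Cmod]. }
  rewrite S_INR. pose proof (Rabs_pos A). repeat split; lra.
Qed.

Lemma shifted_zeta_partial_sums (v : C) (x : R) : (1 < x)%R ->
  exists J0 T, forall J n, (J0 <= J)%nat ->
    (rsum (fun k => exp (- x * ln (Cmod (v + INR (J + k))))) n <= T)%R.
Proof.
  intros Hx. destruct (shift_eventually v 1) as [J0 HJ].
  exists J0, (exp (x * ln 2) * (x / (x - 1)))%R. intros J n HJ0.
  apply Rle_trans with (rsum (fun k => exp (x * ln 2) * exp (- x * ln (INR (S (J + k))))) n)%R.
  - apply rsum_le. intros k _. destruct (HJ (J + k)%nat ltac:(lia)) as [_ [H1 H2]].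
    rewrite <- exp_plus. apply exp_le_mono.
    assert (0 < INR (S (J + k)))%R by (apply lt_0_INR; lia).
    assert (ln (INR (S (J + k))) - ln 2 <= ln (Cmod (v + INR (J + k))))%R; [|nra].
    rewrite <- ln_div by lra. apply ln_le; [lra|exact H2].
  - rewrite rsum_scal. apply Rmult_le_compat_l; [left; apply exp_pos|].
    eapply Rle_trans; [|apply (zeta_partial_sums x (J + n) Hx)].
    rewrite rsum_add. pose proof (rsum_nonneg (fun j => exp (- x * ln (INR (S j)))) J
      (fun j => Rlt_le _ _ (exp_pos _))). lra.
Qed.

(** Finitely many terms need not obey the bound; in the application these are
    the [j] for which [v + j] is still small or outside the right half plane. *)
Lemma analytic_at_series (F : nat -> C -> C) (b : nat -> R) s0 (rho T : R) J :
  (0 < rho)%R ->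
  (forall j, analytic_at (F j) s0) ->
  (forall j, (J <= j)%nat -> majorized (F j) s0 rho (b j)) ->
  (forall n, (rsum (fun k => b (J + k)%nat) n <= T)%R) ->
  analytic_at (fun s => Csum (fun j => F j s)) s0 /\
  is_Cseries (fun j => F j s0) (Csum (fun j => F j s0)).
Proof.
  intros Hr Ha Hm HT.
  assert (Hc : forall s, (Cmod (s - s0) <= rho)%R ->
    is_Cseries (fun k => F (J + k)%nat s) (Csum (fun k => F (J + k)%nat s)) /\
    is_Cseries (fun j => F j s) (Csum (fun j => F j s))).
  { intros s Hs.
    destruct (Cseries_dominated (fun k => F (J + k)%nat s) (fun k => b (J + k)%nat) T) as [l [Hl _]].
    - intro k. apply (majorized_bound s0 rho (F (J + k)%nat)); [apply Hm; lia|exact Hs].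
    - exact HT.
    - split; [exact (Csum_correct _ _ Hl)|].
      exact (Csum_correct _ _ (proj1 (is_Cseries_shift (fun j => F j s) J l) Hl)). }
  assert (H0 : (Cmod (s0 - s0) <= rho)%R).
  { replace (s0 - s0) with (RtoC 0) by ring. rewrite Cmod_0. lra. }
  split; [|apply Hc, H0].
  apply analytic_at_ext_near with
    (fun s => psum (fun j => F j s) J + Csum (fun k => F (J + k)%nat s)).
  - exists rho. split; [exact Hr|]. intros s Hs. destruct (Hc s ltac:(lra)) as [H1 H2].
    exact (is_Cseries_unique _ _ _ (proj1 (is_Cseries_shift (fun j => F j s) J _) H1) H2).
  - apply analytic_at_plus.
    + apply analytic_at_psum. intros; apply Ha.
    + apply analytic_at_majorized. exists rho, T. split; [exact Hr|].
      apply (majorized_series _ _ Hr (fun k => F (J + k)%nat) _ (fun k => b (J + k)%nat)).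
      * intro k. apply Hm. lia.
      * exact HT.
      * intros s Hs. exact (proj1 (Hc s Hs)).
Qed.

Definition remainder_term (z v : C) (N : nat) (w : C) (j : nat) : C :=
  z ^ j * binomial_remainder (v + INR j) N w.

Lemma remainder_series_analytic z v N w0 :
  Cmod z = 1%R -> (Re w0 < INR N - 1)%R ->
  analytic_at (fun w => Csum (remainder_term z v N w)) w0 /\
  is_Cseries (remainder_term z v N w0) (Csum (remainder_term z v N w0)).
Proof.
  intros Hz Hw.
  (* [x] is halfway between 1 and [N - Re w0], so that the terms decay like
     [|v + j| ^ (- x)] on a disc of positive radius *)
  set (x := ((INR N - Re w0 + 1) / 2)%R).
  assert (Hx : (1 < x)%R) by (unfold x; lra).
  set (rho := (INR N - Re w0 - x)%R). assert (Hrho : (0 < rho)%R) by (unfold rho, x; lra).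
  destruct (shifted_zeta_partial_sums v x Hx) as [J1 [T HT]].
  destruct (shift_eventually v (1 + 2 * (Cmod w0 + rho + 1))) as [J2 HJ2].
  set (K := (2 * (Cmod w0 + rho + 1) ^ N * exp ((Cmod w0 + rho) * PI))%R).
  pose proof (Cmod_ge_0 w0) as Hw0.
  assert (HK : (0 <= K)%R).
  { unfold K. repeat apply Rmult_le_pos; [lra|apply pow_le; lra|left; apply exp_pos]. }
  apply (analytic_at_series (fun j w => remainder_term z v N w j)
    (fun j => K * exp (- x * ln (Cmod (v + INR j))))%R w0 rho (K * T) (J1 + J2) Hrho).
  - intro j. apply analytic_at_scal. unfold binomial_remainder.
    apply analytic_at_minus; [apply analytic_at_Cexp|].
    apply analytic_at_mult; [apply analytic_at_Cexp|].
    apply (analytic_at_psum (fun r w => Cbinom w r * (/ (v + INR j)) ^ r)).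
    intros r _. apply analytic_at_mult; [apply Cbinom_analytic|apply analytic_at_const].
  - intros j Hj. destruct (HJ2 j ltac:(lia)) as [H1 [H2 _]].
    apply majorized_weaken with (Cmod (z ^ j) *
      (K * exp ((Re w0 + rho - INR N) * ln (Cmod (v + INR j)))))%R.
    + rewrite Cmod_pow, Hz, pow1, Rmult_1_l.
      replace (Re w0 + rho - INR N)%R with (- x)%R by (unfold rho; ring). lra.
    + apply majorized_scal. apply majorized_binomial_remainder; lra.
  - intro n. rewrite rsum_scal. apply Rmult_le_compat_l; [exact HK|]. apply HT. lia.
Qed.

(** * Existence of the analytic continuation on the unit circle *)

Lemma Cpower_plus a x y : Cpower a (x + y) = Cpower a x * Cpower a y.
Proof. unfold Cpower. rewrite <- Cexp_plus. f_equal. ring. Qed.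

Lemma Cpower_opp_1 (a : C) : a <> 0 -> Cpower a (- (1)) = / a.
Proof.
  intros Ha. unfold Cpower. replace (- (1) * Clog a) with (- Clog a) by ring.
  rewrite Cexp_opp, Cexp_Clog by exact Ha. reflexivity.
Qed.

Lemma Cpower_minus_nat (a w : C) r : a <> 0 -> Cpower a (w - RtoC (INR r)) = Cpower a w * (/ a) ^ r.
Proof.
  intros Ha. induction r as [|r IH].
  - simpl. replace (w - 0) with w by ring. ring.
  - rewrite S_INR, RtoC_plus. replace (w - (INR r + 1)) with ((w - INR r) + - (1)) by ring.
    rewrite Cpower_plus, IH, Cpower_opp_1 by exact Ha. simpl. ring.
Qed.

Lemma binomial_expansion (a : C) N w : a <> 0 ->
  Cpower (a + 1) w =
  binomial_remainder a N w + psum (fun r => Cbinom w r * Cpower a (w - RtoC (INR r))) N.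
Proof.
  intros Ha. unfold binomial_remainder.
  replace (psum (fun r => Cbinom w r * Cpower a (w - RtoC (INR r))) N) with
    (Cpower a w * psum (fun r => Cbinom w r * (/ a) ^ r) N); [ring|].
  induction N as [|N IH]; simpl; [ring|]. rewrite <- IH, Cpower_minus_nat by exact Ha. ring.
Qed.

(** The boundary term [z ^ n * (v + n) ^ w] tends to 0 because [Re w < 0]. *)
Lemma telescoping_powers z v w : Cmod z = 1%R -> (Re w < 0)%R ->
  is_Cseries (fun j => z ^ S j * Cpower (v + INR (S j)) w - z ^ j * Cpower (v + INR j) w)
    (- Cpower v w).
Proof.
  intros Hz Hw. apply is_Cseries_eps. intros eps He.
  set (K := exp ((Cmod w + 0) * PI)). assert (HK : (0 < K)%R) by apply exp_pos.
  (* [ln |v + n| >= T] gives [K * |v + n| ^ Re w <= eps / e] *)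
  set (T := ((ln (K / eps) + 1) / - Re w)%R).
  destruct (shift_eventually v (Rmax 1 (exp T))) as [J HJ]. exists J. intros n Hn.
  assert (E : psum (fun j => z ^ S j * Cpower (v + INR (S j)) w - z ^ j * Cpower (v + INR j) w) n
    = z ^ n * Cpower (v + INR n) w - Cpower v w).
  { clear. induction n as [|n IH].
    - simpl. replace (v + 0) with v by ring. ring.
    - cbn [psum]. rewrite IH. ring. }
  rewrite E. replace (z ^ n * Cpower (v + INR n) w - Cpower v w - - Cpower v w) with
    (z ^ n * Cpower (v + INR n) w) by ring.
  rewrite Cmod_mult, Cmod_pow, Hz, pow1, Rmult_1_l.
  destruct (HJ n Hn) as [_ [H _]].
  pose proof (Rmax_l 1 (exp T)). pose proof (Rmax_r 1 (exp T)).
  pose proof (Cpower_majorant_le (v + INR n) w 0 ltac:(lra) ltac:(lra)) as Hb.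
  rewrite Rmult_0_l, exp_0, Rmult_1_r, !Rplus_0_r in Hb. unfold Cpower.
  fold (Cpower (v + INR n) w) in Hb |- *.
  eapply Rle_lt_trans; [exact Hb|].
  assert (HT : (T <= ln (Cmod (v + INR n)))%R).
  { rewrite <- (ln_exp T). apply ln_le; [apply exp_pos|lra]. }
  assert (Hle : (Re w * ln (Cmod (v + INR n)) <= - (ln (K / eps) + 1))%R).
  { replace (- (ln (K / eps) + 1))%R with (Re w * T)%R by (unfold T; field; lra). nra. }
  replace (exp (Cmod w * PI)) with K by (unfold K; f_equal; ring).
  apply Rle_lt_trans with (K * exp (- (ln (K / eps) + 1)))%R.
  - apply Rmult_le_compat_l; [lra|]. now apply exp_le_mono.
  - pose proof (Rdiv_lt_0_compat K eps HK He). rewrite Ropp_plus_distr, exp_plus, exp_Ropp, exp_ln by assumption.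
    replace (K * (/ (K / eps) * exp (- (1))))%R with (eps * exp (- (1)))%R by (field; lra).
    pose proof (exp_increasing (- (1)) 0 ltac:(lra)) as Hexp. rewrite exp_0 in Hexp. rewrite <- (Rmult_1_r eps) at 2. apply Rmult_lt_compat_l; [exact He|exact Hexp].
Qed.

Definition lerch_sum (z v s : C) : C := Csum (lerch_term z s v).

(** Without its first term, the series is [z] times the remainder series of
    order 0, which consists of the [z ^ j * (v + j + 1) ^ (- s)]. *)
Lemma lerch_series_analytic z v s0 : Cmod z = 1%R -> (1 < Re s0)%R ->
  analytic_at (lerch_sum z v) s0 /\ is_Cseries (lerch_term z s0 v) (lerch_sum z v s0).
Proof.
  intros Hz Hs.
  assert (Hrem : forall s, (1 < Re s)%R ->
    analytic_at (fun w => Csum (remainder_term z v 0 w)) (- (1) * s + 0) /\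
    is_Cseries (lerch_term z s v)
      (Cpower v (- s) + z * Csum (remainder_term z v 0 (- (1) * s + 0)))).
  { intros s H1.
    destruct (remainder_series_analytic z v 0 (- (1) * s + 0) Hz) as [Ha Hc].
    { unfold Re in *. simpl in *. lra. }
    split; [exact Ha|].
    pose proof (is_Cseries_shift (lerch_term z s v) 1
      (z * Csum (remainder_term z v 0 (- (1) * s + 0)))) as [Sh _].
    eapply is_Cseries_value; [apply Sh|].
    - eapply is_Cseries_ext; [|exact (is_Cseries_scal z _ _ Hc)].
      intro k. unfold lerch_term, remainder_term, binomial_remainder.
      change (1 + k)%nat with (S k). rewrite S_INR, RtoC_plus, Cplus_assoc.
      replace (- (1) * s + 0) with (- s) by ring. simpl. ring.
    - simpl. unfold lerch_term. simpl. replace (v + 0) with v by ring. ring. }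
  split.
  - apply analytic_at_ext_near with
      (fun s => Cpower v (- s) + z * Csum (remainder_term z v 0 (- (1) * s + 0))).
    + apply near_imp with (fun s => (1 < Re s)%R); [|now apply near_Re_gt].
      intros s H1. destruct (Hrem s H1) as [_ Hc].
      exact (is_Cseries_unique _ _ _ Hc (Csum_correct _ _ Hc)).
    + apply analytic_at_plus.
      * apply analytic_at_ext with (fun s => Cpower v (- (1) * s + 0)).
        { intro s. f_equal. ring. }
        apply (analytic_at_isometry (Cpower v)).
        -- apply Cmod_m1.
        -- apply analytic_at_Cexp.
      * apply analytic_at_scal.
        apply (analytic_at_isometry (fun w => Csum (remainder_term z v 0 w))).
        -- apply Cmod_m1.
        -- apply Hrem, Hs.
  - destruct (Hrem s0 Hs) as [_ Hc]. exact (Csum_correct _ _ Hc).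
Qed.

(** The factor [d] removes the pole of the continuation: it is 1 for [z <> 1]
    and [s - 1] for [z = 1]. *)
Definition continuation_above (z v : C) (d : C -> C) (x : R) (f : C -> C) : Prop :=
  (forall s, (x < Re s)%R -> analytic_at f s) /\
  (forall s, (1 < Re s)%R -> f s = d s * lerch_sum z v s).

Lemma analytic_at_remainder_reflected z v N (e s0 : C) :
  Cmod z = 1%R -> (Re (e - s0) < INR N - 1)%R ->
  analytic_at (fun s => Csum (remainder_term z v N (e - s))) s0.
Proof.
  intros Hz Hs.
  apply analytic_at_ext with (fun s => Csum (remainder_term z v N (- (1) * s + e))).
  { intro s. f_equal. f_equal. ring. }
  apply (analytic_at_isometry (fun w => Csum (remainder_term z v N w))); [apply Cmod_m1|].
  replace (- (1) * s0 + e) with (e - s0) by ring.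
  now apply remainder_series_analytic.
Qed.

Lemma analytic_at_Cpower_reflected a e s0 : analytic_at (fun s => Cpower a (e - s)) s0.
Proof.
  apply analytic_at_ext with (fun s => Cpower a (- (1) * s + e)).
  { intro s. f_equal. ring. }
  apply (analytic_at_isometry (Cpower a)); [apply Cmod_m1|apply analytic_at_Cexp].
Qed.

Lemma analytic_at_Cbinom_reflected r e s0 : analytic_at (fun s => Cbinom (e - s) r) s0.
Proof.
  apply analytic_at_ext with (fun s => Cbinom (- (1) * s + e) r).
  { intro s. f_equal. ring. }
  apply (analytic_at_isometry (fun w => Cbinom w r)); [apply Cmod_m1|apply Cbinom_analytic].
Qed.

Lemma analytic_at_translate f h s0 : analytic_at f (s0 + h) -> analytic_at (fun s => f (s + h)) s0.
Proof.
  intros H. apply analytic_at_ext with (fun s => f (1 * s + h)).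
  { intro s. f_equal. ring. }
  apply (analytic_at_isometry f); [apply Cmod_1|]. replace (1 * s0 + h) with (s0 + h) by ring. exact H.
Qed.

Lemma psum_scal c a n : psum (fun k => c * a k) n = c * psum a n.
Proof. induction n as [|n IH]; simpl; [ring|rewrite IH; ring]. Qed.

(** Summing the binomial expansion of [(v + j + 1) ^ (e - s)] over [j]
    relates [lerch_sum] at [s] and at points further to the right; the left
    side telescopes.  The leading terms [(z - 1) * z ^ j * (v + j) ^ (e - s)]
    vanish for [z = 1] and have a convergent sum for [e = 0]. *)
Lemma lerch_recursion (z v e : C) N (s : C) :
  Cmod z = 1%R -> (forall j : nat, v <> - INR j) ->
  (1 < Re s)%R -> (Re (e - s) < 0)%R -> (z - 1 = 0 \/ e = 0) -> (Re e <= 1)%R ->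
  - Cpower v (e - s) =
    z * Csum (remainder_term z v (S N) (e - s))
    + (z - 1) * lerch_sum z v s
    + psum (fun r => z * Cbinom (e - s) (S r) * lerch_sum z v (s - e + RtoC (INR (S r)))) N.
Proof.
  intros Hz Hv Hs Hes Hze He1.
  assert (HN : (Re (e - s) < INR (S N) - 1)%R) by (rewrite S_INR; pose proof (pos_INR N); lra).
  destruct (remainder_series_analytic z v (S N) (e - s) Hz HN) as [_ Hrem].
  apply (is_Cseries_unique _ _ _ (telescoping_powers z v (e - s) Hz Hes)).
  assert (H0 : is_Cseries (fun j => (z - 1) * (z ^ j * Cpower (v + INR j) (e - s)))
    ((z - 1) * lerch_sum z v s)).
  { destruct Hze as [E|E]; rewrite E.
    - apply is_Cseries_ext with (fun j => 0 * lerch_term z s v j); [intros; ring|].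
      apply is_Cseries_scal. now apply lerch_series_analytic.
    - apply is_Cseries_scal. eapply is_Cseries_ext; [|apply lerch_series_analytic; [exact Hz|exact Hs]].
      intro j. unfold lerch_term. replace (0 - s) with (- s) by ring. ring. }
  assert (Hr : forall r, is_Cseries
    (fun j => z * Cbinom (e - s) (S r) * lerch_term z (s - e + RtoC (INR (S r))) v j)
    (z * Cbinom (e - s) (S r) * lerch_sum z v (s - e + RtoC (INR (S r))))).
  { intro r. apply is_Cseries_scal. apply lerch_series_analytic; [exact Hz|].
    rewrite S_INR. pose proof (pos_INR r). unfold Re in *. simpl in *. lra. }
  pose proof (is_Cseries_psum
    (fun j r => z * Cbinom (e - s) (S r) * lerch_term z (s - e + RtoC (INR (S r))) v j)
    _ N (fun r _ => Hr r)) as Hp.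
  eapply is_Cseries_ext; [|exact (is_Cseries_plus _ _ _ _
    (is_Cseries_plus _ _ _ _ (is_Cseries_scal z _ _ Hrem) H0) Hp)].
  intro j. cbv beta.
  assert (Hvj : v + INR j <> 0).
  { intro E. apply (Hv j). replace v with (v + INR j - INR j) by ring. rewrite E. ring. }
  rewrite S_INR, RtoC_plus, Cplus_assoc, (binomial_expansion _ (S N) _ Hvj), psum_incr.
  unfold remainder_term.
  assert (Eq : psum (fun r => z * Cbinom (e - s) (S r) * lerch_term z (s - e + RtoC (INR (S r))) v j) N
    = z * z ^ j * psum (fun k => Cbinom (e - s) (S k) * Cpower (v + INR j) (e - s - RtoC (INR (S k)))) N).
  { rewrite <- psum_scal. apply psum_ext. intros r _. unfold lerch_term.
    replace (- (s - e + RtoC (INR (S r)))) with (e - s - RtoC (INR (S r))) by ring. ring. }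
  rewrite Eq. cbn [Cbinom Cpow]. change (INR 0) with 0%R. replace (e - s - 0) with (e - s) by ring. ring.
Qed.

(** The recursion with [e = 0] is solved for [lerch_sum z v s], whose
    coefficient is [z - 1]. *)
Lemma continuation_step_not_one (z v : C) N f :
  Cmod z = 1%R -> z <> 1 -> (forall j : nat, v <> - INR j) ->
  continuation_above z v (fun _ => 1) (1 - INR N) f ->
  exists g, continuation_above z v (fun _ => 1) (1 - INR (S N)) g.
Proof.
  intros Hz Hz1 Hv [Hf1 Hf2].
  assert (Hzn : 1 - z <> 0).
  { intro E. apply Hz1. replace z with (1 - (1 - z)) by ring. rewrite E. ring. }
  exists (fun s => / (1 - z) * (Cpower v (0 - s) + (z * Csum (remainder_term z v (S N) (0 - s))
    + psum (fun r => z * Cbinom (0 - s) (S r) * f (s + RtoC (INR (S r)))) N))).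
  split.
  - intros s Hs. rewrite S_INR in Hs.
    apply analytic_at_scal, analytic_at_plus; [apply analytic_at_Cpower_reflected|].
    apply analytic_at_plus.
    + apply analytic_at_scal, analytic_at_remainder_reflected; [exact Hz|].
      rewrite S_INR. unfold Re in *. simpl. lra.
    + apply (analytic_at_psum (fun r s => z * Cbinom (0 - s) (S r) * f (s + RtoC (INR (S r))))).
      intros r _. apply analytic_at_mult.
      * apply analytic_at_scal, analytic_at_Cbinom_reflected.
      * apply analytic_at_translate, Hf1. rewrite S_INR. pose proof (pos_INR r).
        unfold Re in *. simpl. lra.
  - intros s Hs.
    pose proof (lerch_recursion z v 0 N s Hz Hv Hs) as H.
    specialize (H ltac:(unfold Re in *; simpl; lra) (or_intror eq_refl) ltac:(unfold Re; simpl; lra)).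
    assert (E : psum (fun r => z * Cbinom (0 - s) (S r) * f (s + RtoC (INR (S r)))) N =
      psum (fun r => z * Cbinom (0 - s) (S r) * lerch_sum z v (s - 0 + RtoC (INR (S r)))) N).
    { apply psum_ext. intros r _. rewrite Hf2.
      - replace (s - 0 + RtoC (INR (S r))) with (s + RtoC (INR (S r))) by ring. ring.
      - rewrite S_INR. pose proof (pos_INR r). unfold Re in *. simpl. lra. }
    rewrite E.
    replace (Cpower v (0 - s)) with (- - Cpower v (0 - s)) by ring. rewrite H.
    field. exact Hzn.
Qed.

(** The recursion with [e = 1] is solved for [(s - 1) * lerch_sum 1 v s].  In
    it the coefficient of [lerch_sum 1 v (s + r)] is divisible by [s + r - 1],
    so that only the function without pole occurs on the right as well. *)
Lemma continuation_step_one (v : C) N f :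
  (forall j : nat, v <> - INR j) ->
  continuation_above 1 v (fun s => s - 1) (1 - INR N) f ->
  exists g, continuation_above 1 v (fun s => s - 1) (1 - INR (S N)) g.
Proof.
  intros Hv [Hf1 Hf2].
  exists (fun s => Cpower v (1 - s) + Csum (remainder_term 1 v (S (S N)) (1 - s))
    - psum (fun r => / RtoC (INR (S (S r))) * Cbinom (1 - s) (S r) * f (s + RtoC (INR (S r)))) N).
  split.
  - intros s Hs. rewrite S_INR in Hs.
    apply analytic_at_minus; [apply analytic_at_plus|].
    + apply analytic_at_Cpower_reflected.
    + apply analytic_at_remainder_reflected; [apply Cmod_1|].
      rewrite !S_INR. unfold Re in *. simpl. lra.
    + apply (analytic_at_psum (fun r s => / RtoC (INR (S (S r))) * Cbinom (1 - s) (S r) * f (s + RtoC (INR (S r))))).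
      intros r _. apply analytic_at_mult.
      * apply analytic_at_scal, analytic_at_Cbinom_reflected.
      * apply analytic_at_translate, Hf1. rewrite S_INR. pose proof (pos_INR r).
        unfold Re in *. simpl. lra.
  - intros s Hs.
    pose proof (lerch_recursion 1 v 1 (S N) s Cmod_1 Hv Hs) as H.
    specialize (H ltac:(unfold Re in *; simpl; lra) ltac:(left; ring) ltac:(unfold Re; simpl; lra)).
    rewrite psum_incr in H.
    assert (E : psum (fun r => / RtoC (INR (S (S r))) * Cbinom (1 - s) (S r) * f (s + RtoC (INR (S r)))) N =
      - (1) * psum (fun k => 1 * Cbinom (1 - s) (S (S k)) * lerch_sum 1 v (s - 1 + RtoC (INR (S (S k))))) N).
    { rewrite <- psum_scal. apply psum_ext. intros r _. rewrite Hf2.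
      - replace (s - 1 + RtoC (INR (S (S r)))) with (s + RtoC (INR (S r)))
          by (rewrite (S_INR (S r)), RtoC_plus; ring).
        change (Cbinom (1 - s) (S (S r))) with
          (Cbinom (1 - s) (S r) * ((1 - s - RtoC (INR (S r))) / RtoC (INR (S (S r))))).
        field. apply RtoC_neq_0. pose proof (lt_0_INR (S (S r)) ltac:(lia)). lra.
      - rewrite S_INR. pose proof (pos_INR r). unfold Re in *. simpl. lra. }
    rewrite E.
    replace (Cpower v (1 - s)) with (- - Cpower v (1 - s)) by ring. rewrite H.
    change (Cbinom (1 - s) 1) with (1 * ((1 - s - RtoC (INR 0)) / RtoC (INR 1))).
    change (INR 0) with 0%R. change (INR 1) with 1%R.
    replace (s - 1 + 1) with s by ring. field.
Qed.

(** Continuations to larger and larger half planes agree where they are both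
    defined, hence glue to an entire function. *)
Lemma continuation_glue z v d :
  (forall N, exists f, continuation_above z v d (1 - INR N) f) ->
  exists f, (forall s, analytic_at f s) /\
    forall s, (1 < Re s)%R -> f s = d s * lerch_sum z v s.
Proof.
  intros H.
  set (P := fun s y => exists N g, (1 - INR N < Re s)%R /\
    continuation_above z v d (1 - INR N) g /\ y = g s).
  set (f := fun s => @iota C_CompleteNormedModule (P s)).
  assert (Hf : forall N g s, continuation_above z v d (1 - INR N) g -> (1 - INR N < Re s)%R ->
    f s = g s).
  { intros N g s Hg Hs. unfold f.
    apply (@iota_unique _ C_CompleteNormedModule (P s) (g s)); [|now exists N, g].
    intros y [N' [g' [Hs' [Hg' ->]]]]. destruct Hg as [G1 G2]. destruct Hg' as [G1' G2'].
    apply (analytic_eq_half_plane g' g (Rmax (1 - INR N) (1 - INR N'))).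
    - intros t Ht. split; [apply G1'|apply G1]; eapply Rle_lt_trans; try exact Ht;
        [apply Rmax_r|apply Rmax_l].
    - intros t Ht. now rewrite G2, G2'.
    - now apply Rmax_lub_lt. }
  assert (HN : forall s : C, exists N, (1 - INR N < Re s)%R).
  { intro s. destruct (INR_unbounded (1 - Re s)) as [N HN]. exists N. lra. }
  exists f. split.
  - intros s. destruct (HN s) as [N Hs]. destruct (H N) as [g Hg].
    apply analytic_at_ext_near with g; [|now apply Hg].
    apply near_imp with (fun s => (1 - INR N < Re s)%R); [|now apply near_Re_gt].
    intros t Ht. symmetry. now apply (Hf N).
  - intros s Hs. destruct (H O) as [g Hg]. rewrite (Hf O g s Hg); [now apply Hg|]. simpl. lra.
Qed.

Lemma lerch_continuation_exists (z v : C) :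
  Cmod z = 1%R -> (forall j : nat, v <> - INR j) ->
  exists f, is_lerch_continuation z v f.
Proof.
  intros Hz Hv. destruct (classic (z = 1)) as [->|Hz1].
  - destruct (continuation_glue 1 v (fun s => s - 1)) as [f [Hf1 Hf2]].
    { induction N as [|N [f IH]].
      - exists (fun s => (s - 1) * lerch_sum 1 v s). split; [|reflexivity].
        intros s Hs. apply analytic_at_mult.
        + apply analytic_at_minus; [apply analytic_at_id|apply analytic_at_const].
        + apply lerch_series_analytic; [exact Hz|]. simpl in Hs. lra.
      - exact (continuation_step_one v N f Hv IH). }
    exists (fun s => / (s - 1) * f s). split.
    + intros s Hs. unfold is_lerch_series.
      destruct (lerch_series_analytic 1 v s Hz Hs) as [_ Hl].
      eapply is_Cseries_value; [exact Hl|]. rewrite Hf2 by exact Hs. field.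
      intro E. apply (f_equal fst) in E. unfold Re in Hs. simpl in E. lra.
    + intros s Hs. apply analytic_at_mult; [|apply Hf1].
      apply (analytic_at_inv 1). intro E. apply Hs. now split.
  - destruct (continuation_glue z v (fun _ => 1)) as [f [Hf1 Hf2]].
    { induction N as [|N [f IH]].
      - exists (lerch_sum z v). split; [|intros; ring].
        intros s Hs. apply lerch_series_analytic; [exact Hz|]. simpl in Hs. lra.
      - exact (continuation_step_not_one z v N f Hz Hz1 Hv IH). }
    exists f. split.
    + intros s Hs. unfold is_lerch_series.
      destruct (lerch_series_analytic z v s Hz Hs) as [_ Hl].
      eapply is_Cseries_value; [exact Hl|]. rewrite Hf2 by exact Hs. ring.
    + intros s _. apply Hf1.
Qed.

(** * Values of the Hurwitz-Lerch function and trisection *)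

(** The terms grow at most like a power of [j], hence slower than any increasing
    geometric sequence: [X * ln y <= (t / 2) * y + const], while [|z| ^ j] decays at
    least like [exp (- t * j)]. *)
Lemma lerch_series_disc (z s v : C) : (Cmod z < 1)%R -> exists l, is_Cseries (lerch_term z s v) l.
Proof.
  intros Hz. pose proof (Cmod_ge_0 z) as Hz0.
  (* an upper bound of [|z|] that is positive also for [z = 0] *)
  set (q := ((Cmod z + 1) / 2)%R). set (t := (- ln q)%R).
  assert (Hq : (Cmod z <= q < 1 /\ 0 < q)%R) by (unfold q; lra).
  assert (Ht : (0 < t)%R).
  { unfold t. rewrite <- Ropp_0, <- ln_1. apply Ropp_lt_contravar, ln_increasing; lra. }
  set (X := Rabs (Re (- s))). assert (HX : (0 <= X)%R) by apply Rabs_pos.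
  set (d := (t / (2 * (X + 1)))%R).
  assert (Hd : (0 < d)%R) by (apply Rdiv_lt_0_compat; lra).
  assert (HXd : (X * d <= t / 2)%R).
  { replace (t / 2)%R with ((X + 1) * d)%R by (unfold d; field; lra). nra. }
  destruct (shift_eventually v 1) as [J HJ].
  set (K := (exp (Cmod (- s) * PI) * exp (X * (d * Cmod v - 1 - ln d)))%R).
  assert (HK : (0 < K)%R) by (apply Rmult_lt_0_compat; apply exp_pos).
  set (p := exp (- (t / 2))).
  assert (Hp : (0 < p < 1)%R).
  { split; [apply exp_pos|]. rewrite <- exp_0. apply exp_increasing. lra. }
  assert (Hpow : forall (y : R) j, (exp y ^ j = exp (INR j * y))%R).
  { intros y j. induction j as [|j IH]; [simpl; rewrite Rmult_0_l, exp_0; reflexivity|].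
    rewrite S_INR. simpl. rewrite IH, <- exp_plus. f_equal. ring. }
  assert (Hb : forall j, (J <= j)%nat -> (Cmod (lerch_term z s v j) <= K * p ^ j)%R).
  { intros j Hj. destruct (HJ j Hj) as [_ [H1 _]].
    unfold lerch_term. rewrite Cmod_mult, Cmod_pow.
    pose proof (Cpower_majorant_le (v + INR j) (- s) 0 H1 ltac:(lra)) as Hm.
    rewrite Rmult_0_l, exp_0, Rmult_1_r, !Rplus_0_r in Hm.
    set (y := Cmod (v + INR j)) in *.
    assert (Hy : (y <= Cmod v + INR j)%R).
    { unfold y. eapply Rle_trans; [apply Cmod_triangle|]. rewrite Cmod_R, Rabs_pos_eq; [lra|apply pos_INR]. }
    assert (Hlny : (ln y <= d * y - 1 - ln d)%R).
    { pose proof (exp_ineq1_le (ln d + ln y)) as H.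
      rewrite exp_plus, !exp_ln in H by lra. lra. }
    assert (Hl0 : (0 <= ln y)%R) by (rewrite <- ln_1; apply ln_le; lra).
    assert (Hexp : (exp (Re (- s) * ln y) <= exp (X * (d * Cmod v - 1 - ln d)) * exp (INR j * (t / 2)))%R).
    { rewrite <- exp_plus. apply exp_le_mono.
      apply Rle_trans with (X * ln y)%R.
      - apply Rmult_le_compat_r; [exact Hl0|]. apply Rle_abs.
      - pose proof (pos_INR j).
        assert (X * ln y <= X * (d * (Cmod v + INR j) - 1 - ln d))%R.
        { apply Rmult_le_compat_l; [exact HX|]. nra. }
        assert (INR j * (X * d) <= INR j * (t / 2))%R by now apply Rmult_le_compat_l.
        lra. }
    assert (Hzj : (Cmod z ^ j <= exp (INR j * - t))%R).
    { rewrite <- Hpow. unfold t. rewrite Ropp_involutive, exp_ln by lra.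
      apply pow_incr. lra. }
    assert (Ep : (p ^ j = exp (INR j * (t / 2)) * exp (INR j * - t))%R).
    { unfold p. rewrite Hpow, <- exp_plus. f_equal. field. }
    rewrite Ep. unfold K. unfold Cpower.
    set (e1 := exp (Cmod (- s) * PI)) in *. assert (0 < e1)%R by apply exp_pos.
    rewrite (Rmult_assoc e1), <- (Rmult_assoc _ _ (exp (INR j * - t))), <- (Rmult_assoc e1).
    apply Rmult_le_compat; [apply Cmod_ge_0|apply pow_le; lra| |exact Hzj].
    eapply Rle_trans; [exact Hm|]. apply Rmult_le_compat_l; [lra|exact Hexp]. }
  assert (Hgeom : forall n, (rsum (fun k => p ^ k) n <= / (1 - p))%R).
  { intro n. assert (E : (rsum (fun k => p ^ k) n = (1 - p ^ n) / (1 - p))%R).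
    { induction n as [|n IH]; simpl; [field; lra|]. rewrite IH. field. lra. }
    rewrite E. pose proof (pow_lt p n (proj1 Hp)).
    rewrite <- (Rmult_1_l (/ (1 - p))). apply Rmult_le_compat_r; [|lra].
    left. apply Rinv_0_lt_compat. lra. }
  destruct (Cseries_dominated (fun k => lerch_term z s v (J + k)) (fun k => K * p ^ J * p ^ k)%R
    (K * p ^ J * / (1 - p))) as [l [Hl _]].
  - intro n. rewrite Rmult_assoc, <- pow_add. apply Hb. lia.
  - intro n. rewrite rsum_scal. apply Rmult_le_compat_l; [|apply Hgeom].
    apply Rmult_le_pos; [lra|]. apply pow_le; lra.
  - apply is_Cseries_shift in Hl. eexists; exact Hl.
Qed.

(** On the unit circle this is the identity theorem on the plane, punctured at
    1 when [z = 1]. *)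
Lemma is_hurwitz_lerch_unique (z s v w1 w2 : C) :
  lerch_defined z s v -> is_hurwitz_lerch z s v w1 -> is_hurwitz_lerch z s v w2 -> w1 = w2.
Proof.
  intros [_ Hd] [[H1 L1]|[H1 [f1 [[A1 B1] ->]]]] [[H2 L2]|[H2 [f2 [[A2 B2] ->]]]]; try lra.
  - exact (is_Cseries_unique _ _ _ L1 L2).
  - apply (analytic_eq_except_one f1 f2 (fun s => ~ (z = 1 /\ s = 1))).
    + intros t Ht [_ E]. exact (Ht E).
    + intros t Ht. split; [now apply B1|now apply B2].
    + intros t Ht. exact (is_Cseries_unique _ _ _ (A1 t Ht) (A2 t Ht)).
    + exact Hd.
Qed.

Lemma hurwitz_lerch_eq (z s v w : C) :
  lerch_defined z s v -> is_hurwitz_lerch z s v w -> hurwitz_lerch z s v = w.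
Proof.
  intros Hd Hw. apply (@iota_unique _ C_CompleteNormedModule); [|exact Hw].
  intros y Hy. exact (is_hurwitz_lerch_unique _ _ _ _ _ Hd Hy Hw).
Qed.

Lemma psum_trisect a n :
  psum a (3 * n) = psum (fun i => a (3 * i)%nat + a (3 * i + 1)%nat + a (3 * i + 2)%nat) n.
Proof.
  induction n as [|n IH]; [reflexivity|].
  replace (3 * S n)%nat with (3 * n + 3)%nat by lia. rewrite psum_add, IH. simpl psum.
  replace (n + (n + (n + 0)) + 0)%nat with (3 * n)%nat by lia.
  replace (n + (n + (n + 0)))%nat with (3 * n)%nat by lia. ring.
Qed.

Lemma Cseries_trisect a l l' :
  is_Cseries a l ->
  is_Cseries (fun i => a (3 * i)%nat + a (3 * i + 1)%nat + a (3 * i + 2)%nat) l' -> l = l'.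
Proof.
  intros H H'. apply (is_Cseries_unique (fun i => a (3 * i)%nat + a (3 * i + 1)%nat + a (3 * i + 2)%nat)); [|exact H'].
  rewrite is_Cseries_eps in H |- *. intros eps He. destruct (H eps He) as [N HN].
  exists N. intros n Hn. rewrite <- psum_trisect. apply HN. lia.
Qed.

Lemma lerch_term_trisect (z s v v' : C) (i r : nat) :
  v + RtoC (INR r) = RtoC 3 * v' -> v' + INR i <> 0 ->
  lerch_term z s v (3 * i + r) =
  Cexp (- s * RtoC (ln 3)) * (z ^ r * lerch_term (z ^ 3) s v' i).
Proof.
  intros Hv Hn. unfold lerch_term.
  assert (E : v + INR (3 * i + r) = RtoC 3 * (v' + INR i)).
  { rewrite plus_INR, mult_INR, RtoC_plus, RtoC_mult. change (INR 3) with (1 + 1 + 1)%R.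
    replace (1 + 1 + 1)%R with 3%R by ring.
    replace (v + (3 * INR i + INR r)) with (v + INR r + 3 * INR i) by ring. rewrite Hv. ring. }
  rewrite E. unfold Cpower. rewrite Clog_scale by (exact Hn || lra).
  rewrite Cmult_plus_distr_l, Cexp_plus, Cpow_add_r, Cpow_mult_r. ring.
Qed.

Lemma lerch_series_trisect (z s v v1 v2 v3 l l1 l2 l3 : C) :
  v = RtoC 3 * v1 -> v + 1 = RtoC 3 * v2 -> v + 2 = RtoC 3 * v3 ->
  (forall j : nat, v1 <> - INR j) -> (forall j : nat, v2 <> - INR j) ->
  (forall j : nat, v3 <> - INR j) ->
  is_Cseries (lerch_term z s v) l ->
  is_Cseries (lerch_term (z ^ 3) s v1) l1 ->
  is_Cseries (lerch_term (z ^ 3) s v2) l2 ->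
  is_Cseries (lerch_term (z ^ 3) s v3) l3 ->
  l = Cexp (- s * RtoC (ln 3)) * (l1 + z * l2 + z ^ 2 * l3).
Proof.
  intros E1 E2 E3 N1 N2 N3 Hl H1 H2 H3.
  assert (Hn : forall v : C, (forall j : nat, v <> - INR j) -> forall i, v + INR i <> 0).
  { intros u Hu i E. apply (Hu i). replace u with (u + INR i - INR i) by ring. rewrite E. ring. }
  apply (Cseries_trisect _ _ _ Hl).
  eapply is_Cseries_ext; [|exact (is_Cseries_scal (Cexp (- s * RtoC (ln 3))) _ _
    (is_Cseries_plus _ _ _ _ (is_Cseries_plus _ _ _ _ H1 (is_Cseries_scal z _ _ H2))
       (is_Cseries_scal (z ^ 2) _ _ H3)))].
  intro i. cbv beta.
  rewrite <- (Nat.add_0_r (3 * i)) at 1.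
  rewrite (lerch_term_trisect z s v v1 i 0), (lerch_term_trisect z s v v2 i 1),
    (lerch_term_trisect z s v v3 i 2).
  - simpl. ring.
  - simpl. replace (1 + 1)%R with 2%R by ring. exact E3.
  - now apply Hn.
  - simpl. exact E2.
  - now apply Hn.
  - simpl. rewrite <- E1. ring.
  - now apply Hn.
Qed.

(** For [Re s > 1], or inside the unit disc, this groups the defining series
    by residues modulo 3; on the unit circle it extends to all [s] by
    uniqueness of analytic continuation. *)
Lemma hurwitz_lerch_trisection (z s v v1 v2 v3 : C) :
  (Cmod z <= 1)%R ->
  v = RtoC 3 * v1 -> v + 1 = RtoC 3 * v2 -> v + 2 = RtoC 3 * v3 ->
  lerch_defined (z ^ 3) s v1 -> lerch_defined (z ^ 3) s v2 -> lerch_defined (z ^ 3) s v3 ->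
  hurwitz_lerch z s v = Cexp (- s * RtoC (ln 3)) *
    (hurwitz_lerch (z ^ 3) s v1 + z * hurwitz_lerch (z ^ 3) s v2
     + z ^ 2 * hurwitz_lerch (z ^ 3) s v3).
Proof.
  intros Hz E1 E2 E3 D1 D2 D3.
  pose proof D1 as [N1 Hs]. pose proof D2 as [N2 _]. pose proof D3 as [N3 _].
  assert (Nv : forall j : nat, v <> - INR j).
  { intros j E.
    assert (exists i, (j = 3 * i \/ j = 3 * i + 1 \/ j = 3 * i + 2)%nat) as [i Hi].
    { exists (j / 3)%nat. pose proof (Nat.div_mod_eq j 3). pose proof (Nat.mod_upper_bound j 3). lia. }
    assert (H3 : RtoC 3 <> 0) by (apply RtoC_neq_0; lra).
    assert (Hi3 : RtoC (INR (3 * i)) = RtoC 3 * RtoC (INR i)).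
    { rewrite mult_INR, RtoC_mult. f_equal. f_equal. simpl. ring. }
    destruct Hi as [-> | [-> | ->]].
    - apply (N1 i). replace v1 with (RtoC 3 * v1 / RtoC 3) by (field; exact H3).
      rewrite <- E1, E, Hi3. field; exact H3.
    - apply (N2 i). replace v2 with (RtoC 3 * v2 / RtoC 3) by (field; exact H3).
      rewrite <- E2, E, plus_INR, RtoC_plus, Hi3. change (INR 1) with 1%R. field; exact H3.
    - apply (N3 i). replace v3 with (RtoC 3 * v3 / RtoC 3) by (field; exact H3).
      rewrite <- E3, E, plus_INR, RtoC_plus, Hi3. change (INR 2) with 2%R. field; exact H3. }
  assert (Dv : lerch_defined z s v).
  { split; [exact Nv|]. intros [-> ->]. apply Hs. split; [apply Cpow_1_l|reflexivity]. }
  destruct (Rle_lt_or_eq_dec _ _ Hz) as [Hlt|Heq].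
  - assert (Hlt3 : (Cmod (z ^ 3) < 1)%R).
    { rewrite Cmod_pow. pose proof (Cmod_ge_0 z). simpl. nra. }
    assert (Hdisc : forall z' v', (Cmod z' < 1)%R -> lerch_defined z' s v' ->
      is_Cseries (lerch_term z' s v') (hurwitz_lerch z' s v')).
    { intros z' v' Hz' D. destruct (lerch_series_disc z' s v' Hz') as [l Hl].
      rewrite (hurwitz_lerch_eq z' s v' l D); [exact Hl|]. left. split; assumption. }
    apply (lerch_series_trisect z s v v1 v2 v3); auto.
  - assert (Heq3 : Cmod (z ^ 3) = 1%R) by (rewrite Cmod_pow, Heq; ring).
    destruct (lerch_continuation_exists z v Heq Nv) as [f [Af Bf]].
    destruct (lerch_continuation_exists (z ^ 3) v1 Heq3 N1) as [f1 [A1 B1]].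
    destruct (lerch_continuation_exists (z ^ 3) v2 Heq3 N2) as [f2 [A2 B2]].
    destruct (lerch_continuation_exists (z ^ 3) v3 Heq3 N3) as [f3 [A3 B3]].
    rewrite (hurwitz_lerch_eq z s v (f s) Dv) by (right; split; [exact Heq|now exists f]).
    rewrite (hurwitz_lerch_eq (z ^ 3) s v1 (f1 s) D1) by (right; split; [exact Heq3|now exists f1]).
    rewrite (hurwitz_lerch_eq (z ^ 3) s v2 (f2 s) D2) by (right; split; [exact Heq3|now exists f2]).
    rewrite (hurwitz_lerch_eq (z ^ 3) s v3 (f3 s) D3) by (right; split; [exact Heq3|now exists f3]).
    (* [z ^ 3 = 1] is possible with [z <> 1]; the right side then has no value
       at 1 although the left side does, so both are compared off 1 only *)
    apply (analytic_eq_except_one f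
      (fun s => Cexp (- s * RtoC (ln 3)) * (f1 s + z * f2 s + z ^ 2 * f3 s))
      (fun s => ~ (z ^ 3 = 1 /\ s = 1))).
    + intros t Ht [_ E]. exact (Ht E).
    + intros t Ht. split.
      * apply Bf. intros [-> ->]. apply Ht. split; [apply Cpow_1_l|reflexivity].
      * apply analytic_at_mult.
        -- apply analytic_at_ext with (fun s => Cexp (s * - RtoC (ln 3))).
           { intro x. f_equal. ring. }
           apply analytic_at_Cexp.
        -- apply analytic_at_plus; [apply analytic_at_plus|]; try apply analytic_at_scal; auto.
    + intros t Ht. apply (lerch_series_trisect z t v v1 v2 v3); auto;
        [now apply Af|now apply A1|now apply A2|now apply A3].
    + exact Hs.
Qed.

(** * The finite sum *)

Lemma Cexp_pow x n : Cexp x ^ n = Cexp (RtoC (INR n) * x).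
Proof.
  induction n as [|n IH].
  - simpl. rewrite Cmult_0_l, Cexp_0. reflexivity.
  - rewrite Cpow_S, IH, <- Cexp_plus, S_INR, RtoC_plus. f_equal. ring.
Qed.

Lemma pow3_neq_0 n : RtoC 3 ^ n <> 0.
Proof. apply Cpow_nz, RtoC_neq_0. lra. Qed.

Lemma Ci_neq_0 : Ci <> 0.
Proof. intro E. apply (f_equal snd) in E. simpl in E. lra. Qed.

Theorem theorem6p3 (n : nat) (k a m : C)
  (hn : (1 <= n)%nat)
  (hm : (0 <= Im m)%R)
  (hlhs : forall p : nat, (p < n)%nat ->
     lerch_defined (- Cexp (2 * Ci * 3 ^ (p + 1) * m)) (- k)
       (1 / 6 * (/ 3 ^ p * a + 2)) /\
     lerch_defined (- Cexp (2 * Ci * 3 ^ (p + 1) * m)) (- k)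
       (1 / 6 * (/ 3 ^ p * a + 4)) /\
     lerch_defined (- Cexp (2 * Ci * 3 ^ (p + 1) * m)) (- k)
       (1 / 6 * (/ 3 ^ p * a + 6)))
  (hrhs : lerch_defined (- Cexp (2 * Ci * 3 ^ n * m)) (- k)
            (/ 3 ^ n * a / 2 + 1)) :
  @sum_n C_AbelianMonoid (fun p : nat =>
    / 3 ^ p * Cpower (Ci * 3 ^ (p + 1)) k * Cexp (2 * Ci * m * 3 ^ p) *
    (3 * (3 ^ p - 1) *
       hurwitz_lerch (- Cexp (2 * Ci * 3 ^ (p + 1) * m)) (- k)
         (1 / 6 * (/ 3 ^ p * a + 2))
     - 3 * (3 ^ p - 1) * Cexp (2 * Ci * m * 3 ^ p) *
       hurwitz_lerch (- Cexp (2 * Ci * 3 ^ (p + 1) * m)) (- k)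
         (1 / 6 * (/ 3 ^ p * a + 4))
     - 2 * Cexp (4 * Ci * m * 3 ^ p) *
       hurwitz_lerch (- Cexp (2 * Ci * 3 ^ (p + 1) * m)) (- k)
         (1 / 6 * (/ 3 ^ p * a + 6)))) (n - 1)
  = - (3) * Ci * (3 ^ n - 1) * Cpower (Ci * 3 ^ n) (k - 1) *
    Cexp (2 * Ci * m * 3 ^ n) *
    hurwitz_lerch (- Cexp (2 * Ci * 3 ^ n * m)) (- k)
      (/ 3 ^ n * a / 2 + 1).
Proof.
  rewrite sum_n_psum. replace (S (n - 1)) with n by lia.
  match goal with |- ?x = ?y => change (@eq C x y) end.
  (* the middle term is [- T n], an expression that makes sense for [n = 0] *)
  transitivity (- (3 * / 3 ^ n * (3 ^ n - 1) * Cpower (Ci * 3 ^ n) k * Cexp (2 * Ci * m * 3 ^ n) *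
    hurwitz_lerch (- Cexp (2 * Ci * 3 ^ n * m)) (- k) (/ 3 ^ n * a / 2 + 1))).
  2:{ assert (Hw : Ci * 3 ^ n <> 0) by (apply Cmult_neq_0; [apply Ci_neq_0|apply pow3_neq_0]).
      replace (k - 1) with (k + - (1)) by ring. rewrite Cpower_plus, Cpower_opp_1 by exact Hw.
      field. split; [apply pow3_neq_0|apply Ci_neq_0]. }
  clear hn hrhs. induction n as [|n IH].
  { simpl. ring. }
  cbn [psum]. rewrite IH by (intros p Hp; apply hlhs; lia). clear IH.
  destruct (hlhs n ltac:(lia)) as [D1 [D2 D3]]. clear hlhs.
  set (E := Cexp (2 * Ci * m * 3 ^ n)).
  assert (Hz : - Cexp (2 * Ci * 3 ^ n * m) = - E) by (unfold E; do 2 f_equal; ring).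
  assert (Hz3 : - Cexp (2 * Ci * 3 ^ (n + 1) * m) = (- E) ^ 3).
  { transitivity (- (E ^ 3)); [|ring]. unfold E. rewrite Cexp_pow, Nat.add_1_r, Cpow_S.
    do 2 f_equal. simpl. replace (1 + 1 + 1)%R with 3%R by ring. ring. }
  assert (HE3 : Cexp (2 * Ci * m * 3 ^ S n) = E ^ 3).
  { unfold E. rewrite Cexp_pow, Cpow_S.
    f_equal. simpl. replace (1 + 1 + 1)%R with 3%R by ring. ring. }
  assert (HE2 : Cexp (4 * Ci * m * 3 ^ n) = E ^ 2).
  { unfold E. rewrite Cexp_pow. f_equal. simpl. replace (1 + 1)%R with 2%R by ring. ring. }
  assert (Hmod : (Cmod (- E) <= 1)%R).
  { rewrite Cmod_opp. unfold E. rewrite Cmod_Cexp, <- RtoC_pow, <- exp_0. apply exp_le_mono.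
    unfold Re, Im in *. simpl. pose proof (pow_le 3 n ltac:(lra)). nra. }
  rewrite Nat.add_1_r in *. rewrite Hz3 in *. rewrite Hz, HE3, HE2.
  assert (H3n := pow3_neq_0 n).
  assert (H3 : RtoC 3 <> 0) by (apply RtoC_neq_0; lra).
  assert (Hv : / 3 ^ S n * a / 2 + 1 = 1 / 6 * (/ 3 ^ n * a + 6)).
  { rewrite Cpow_S. field. exact H3n. }
  rewrite Hv.
  rewrite (hurwitz_lerch_trisection (- E) (- k) (/ 3 ^ n * a / 2 + 1)
    (1 / 6 * (/ 3 ^ n * a + 2)) (1 / 6 * (/ 3 ^ n * a + 4)) (1 / 6 * (/ 3 ^ n * a + 6)) Hmod);
    [|field; exact H3n|field; exact H3n|field; exact H3n|exact D1|exact D2|exact D3].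
  assert (HW : Cpower (Ci * 3 ^ S n) k = Cexp (- - k * RtoC (ln 3)) * Cpower (Ci * 3 ^ n) k).
  { unfold Cpower. rewrite <- Cexp_plus. f_equal.
    replace (Ci * 3 ^ S n) with (RtoC 3 * (Ci * 3 ^ n)) by (rewrite Cpow_S; ring).
    rewrite Clog_scale; [ring|lra|]. apply Cmult_neq_0; [apply Ci_neq_0|exact H3n]. }
  rewrite HW, (Cpow_S (RtoC 3) n). field. exact H3n.
Qed.
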